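(* Let $\beta$ be a Pisot or Salem number. For $i=1,2,3$ let $(u_i(n))_{n=1}^{\infty}$ be a sequence of positive integers, and assume: Condition (1): there exists a constant $C$ with $0<C<1$ such that, for each $i=1,2,3$, $\log^{+}u_i(n)=o(n^{1-C})$ as $n\to\infty$. Condition (2): $\displaystyle\lim_{n\to\infty}\frac{u_1(n)}{u_2(n)}=\infty$. Then the following hold. (1) For any real numbers $x,y$ with $0<x<y$, the three numbers $$\sum_{n=1}^{\infty}u_1(n)\beta^{-\lfloor\exp((\log n)^{1+x})\rfloor},\quad \sum_{n=1}^{\infty}u_2(n)\beta^{-\lfloor\exp((\log n)^{1+x})\rfloor},\quad \sum_{n=1}^{\infty}u_3(n)\beta^{-\lfloor\exp((\log n)^{1+y})\rfloor}$$ are algebraically independent. (2) The three numbers $$\sum_{n=3}^{\infty}u_1(n)\beta^{-\lfloor n^{\log\log n}\rfloor},\quad \sum_{n=3}^{\infty}u_2(n)\beta^{-\lfloor n^{\log\log n}\rfloor},\quad \sum_{n=1}^{\infty}u_3(n)\beta^{-\lfloor n^{\log n}\rfloor}$$ are algebraically independent. (3) Let $r$ be a real number greater than $1$. Then the three numbers $$\sum_{n=1}^{\infty}u_1(n)\beta^{-\lfloor n^{\log n}\rfloor},\quad \sum_{n=1}^{\infty}u_2(n)\beta^{-\lfloor n^{\log n}\rfloor},\quad \sum_{n=1}^{\infty}u_3(n)\beta^{-\lfloor r^{n}\rfloor}$$ are algebraically independent.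
   Context: For real $x$, $\lfloor x\rfloor$ is the integral part of $x$ and $\log^{+}x=\log\max\{1,x\}$. A Pisot number is an algebraic integer greater than $1$ whose conjugates other than itself all have absolute value less than $1$ (in particular every integer greater than $1$ is a Pisot number). A Salem number is an algebraic integer greater than $1$ whose conjugates other than itself all have absolute value at most $1$, with at least one conjugate of absolute value $1$. Algebraic independence is over $\mathbb{Q}$: complex numbers $\xi_1,\xi_2,\xi_3$ are algebraically independent if $P(\xi_1,\xi_2,\xi_3)\neq0$ for every nonzero $P\in\mathbb{Z}[X_1,X_2,X_3]$. *)

(* Defs.v *)
From HB Require Import structures.
From mathcomp Require Import all_boot all_order all_algebra.
From mathcomp Require Import complex.
(* Only the canonical structures are imported: the notations clash with those
   of mathcomp-analysis. *)
From mathcomp Require mpoly.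
Import (canonicals) mpoly.
From mathcomp Require Import all_classical all_reals all_analysis.

Set Implicit Arguments.
Unset Strict Implicit.
Unset Printing Implicit Defensive.

Import Order.TTheory GRing.Theory Num.Theory.
Import numFieldNormedType.Exports.

Local Open Scope classical_set_scope.
Local Open Scope ring_scope.
Local Open Scope complex_scope.

Definition algebraic_integer (K : numFieldType) (a : K) : Prop :=
  integralOver (intr : int -> K) a.

Definition is_minpoly (K : numFieldType) (p : {poly rat}) (a : K) : Prop :=
  [/\ p \is monic, irreducible_poly p & root (map_poly ratr p) a].

Definition conjugate_of (K : numFieldType) (a z : K) : Prop :=
  exists2 p : {poly rat}, is_minpoly p a & root (map_poly ratr p) z.

(* In Pisot and Salem below the norm is that of R[i], so that the comparisons
   with 1 are between (real) elements of R[i]. *)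
Definition Pisot (R : realType) (beta : R) : Prop :=
  [/\ algebraic_integer beta,
      1 < beta &
      forall z : R[i], conjugate_of beta%:C z -> z <> beta%:C -> `|z| < 1].

Definition Salem (R : realType) (beta : R) : Prop :=
  [/\ algebraic_integer beta,
      1 < beta,
      forall z : R[i], conjugate_of beta%:C z -> z <> beta%:C -> `|z| <= 1 &
      exists2 z : R[i], conjugate_of beta%:C z & `|z| = 1].

Definition algebraically_independent (K : numFieldType) (n : nat)
    (v : n.-tuple K) : Prop :=
  forall P : mpoly.mpoly n int,
    P <> 0 -> mpoly.mmap (intr : int -> K) (tnth v) P <> 0.

Definition log_plus (R : realType) (x : R) : R := ln (Num.max 1 x).

(* The limit exists for the sequences u and exponents w of interest; limn is arbitrary otherwise. *)
Definition power_sum (R : realType) (beta : R) (m : nat) (u : nat -> nat)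
    (w : nat -> R) : R :=
  limn (fun N => \sum_(m <= n < N) (u n)%:R * beta ^ (- Num.floor (w n))).

(* Main.v *)
(* Write theta = 1/beta and f1, f2, f3 for the three numbers, and let w, v be the
   exponents of f1, f2 and of f3.  A relation P(f1, f2, f3) = 0 expands as
   sum_m G_m theta^m = 0 with integers G_m.  If G vanishes on [m - g, m), then
   beta^(m-g) times the part of the sum below m is a polynomial in beta with
   integer coefficients; its conjugates are bounded by the sum of the |G_i| because
   those of beta lie in the closed unit disk, so it is zero or not too small.  It
   equals minus the part from m on, which is tiny for g large.  Hence after a long
   gap the next nonzero coefficient cannot be positive and followed by a long stretch
   of nonnegative ones.

   Such a situation is produced by counting.  Let e be the degree of P in (X1, X2),
   let c be the largest degree in X3 among the terms of that degree, and among these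
   let the largest power of X1 have a positive coefficient.  Since u1/u2 tends to
   infinity, G_m >= 0 whenever m is neither a sum of fewer than e values of w (or of
   e values, one of small index) and some values of v, nor a sum of e values of w and
   fewer than c values of v.  Sums of e values of w outnumber the first kind of
   exceptions, so one of them starts a long interval free of it; inside, a long gap of
   the second kind starts at a sum of e values of w and c - 1 values of v, and adding
   one more value of v yields G_m > 0 far from all exceptions.  The intervals are
   longer than any power of the number of nonzero coefficients they contain, so a
   long gap precedes some positive coefficient. *)
Require Import Defs.
From HB Require Import structures.
From mathcomp Require Import all_boot all_order all_algebra.
From mathcomp Require Import separable qpoly algebraics_fundamentals complex.
From mathcomp Require mpoly.
Import (canonicals) mpoly.
From mathcomp Require Import ring lra zify.
From mathcomp Require Import all_classical all_reals all_analysis.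

Set Implicit Arguments.
Unset Strict Implicit.
Unset Printing Implicit Defensive.

Import Order.TTheory GRing.Theory Num.Theory.
Import numFieldNormedType.Exports.

Local Open Scope classical_set_scope.
Local Open Scope ring_scope.

(** * Minimal polynomials and a Liouville inequality for Pisot and Salem numbers *)

(** Gauss's lemma: the minimal polynomial over the rationals divides a monic integer polynomial, so
    it is proportional to an integer factor of it, whose leading coefficient is then a unit. *)
Lemma minpoly_int (K : numClosedFieldType) (a : K) :
  algebraic_integer a ->
  exists2 p : {poly int}, p \is monic &
    is_minpoly (map_poly intr p) a.
Proof.
move=> aint.
have aQ : integralOver (ratr : rat -> K) a.
  case: aint => q mq rq; exists (map_poly intr q); first exact: monic_map.
  rewrite -map_poly_comp /=.
  by rewrite (eq_map_poly (fun x : int => ratr_int K x)).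
have dec : decidable_embedding (ratr : rat -> K).
  by move=> y; case: (pselect (exists x, y = ratr x)); [left|right].
have [p [mp rp irp]] := minPoly_decidable_closure dec aQ.
case: aint => q mq rq.
have dvd : p %| map_poly intr q.
  apply/idPn; rewrite -irreducible_poly_coprime // => cop.
  have : coprimep (map_poly (ratr : rat -> K) p) (map_poly ratr (map_poly intr q)).
    by rewrite coprimep_map.
  move/coprimep_root => /(_ _ rp); rewrite -map_poly_comp /=.
  by rewrite (eq_map_poly (fun x : int => ratr_int K x)) (rootP rq) eqxx.
have [p1 [c c0 pE] [r qE]] := dvdpP_rat_int dvd.
have lu : lead_coef p1 \is a GRing.unit.
  have := monicP mq; rewrite qE lead_coefM => h.
  by apply/unitrPr; exists (lead_coef r).
(* An integer unit is its own inverse, so this scaling makes [p1] monic. *)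
pose p2 := lead_coef p1 *: p1.
have l2 : lead_coef p1 * lead_coef p1 = 1.
  by move: lu; rewrite unfold_in /= => /orP[] /eqP ->.
have p2m : p2 \is monic by apply/monicP; rewrite lead_coefZ.
exists p2 => //.
suff -> : map_poly intr p2 = p by split.
apply/eqP; rewrite -eqp_monic ?monic_map //.
rewrite pE /p2 map_polyZ /=.
rewrite (eqp_trans (eqp_scale _ _)) ?intr_eq0 //.
  by apply: contraTneq lu => ->; rewrite unitr0.
by rewrite eqp_sym eqp_scale.
Qed.

Lemma irreducible_separable (p : {poly rat}) :
  irreducible_poly p -> separable_poly p.
Proof.
move=> irp; rewrite unlock irreducible_poly_coprime //.
have p1 := irp.1.
have d0 : p^`() != 0.
  apply/eqP => /(congr1 (fun q : {poly rat} => q`_((size p).-2))).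
  rewrite coef_deriv coef0 => /eqP; rewrite mulrn_eq0 /=.
  have -> : (size p).-2.+1 = (size p).-1 by move: p1; case: (size p) => [|[|]].
  by rewrite -/(lead_coef p) lead_coef_eq0 (negbTE (irredp_neq0 irp)).
apply/negP => /(dvdp_leq d0); rewrite leqNgt lt_size_deriv //.
exact: irredp_neq0.
Qed.

(* The matrix of multiplication by [g] modulo [p] is integral, and the
   Vandermonde matrix of the roots of [p] diagonalises it. *)
Lemma prod_horner_roots_int (K : fieldType) (p g : {poly int}) (rs : seq K) :
  p \is monic -> uniq rs ->
  map_poly intr p = \prod_(z <- rs) ('X - z%:P) ->
  exists k : int, k%:~R = \prod_(z <- rs) (map_poly intr g).[z].
Proof.
move=> mp urs pE; pose n := size rs.
have szp : size p = n.+1.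
  by rewrite -(size_prod_XsubC rs id) -pE size_map_poly_id0 // (monicP mp) oner_eq0.
pose v : 'rV[K]_n := \row_j rs`_j.
pose A : 'M[int]_n := \matrix_(i, j) (Pdiv.Ring.rmodp ('X^i * g) p)`_j.
pose D := diag_mx (\row_j (map_poly intr g).[v 0 j] : 'rV[K]_n).
have AV : map_mx intr A *m Vandermonde n v = Vandermonde n v *m D.
  apply/matrixP => i j; rewrite mul_mx_diag !mxE.
  have szr : (size (Pdiv.Ring.rmodp ('X^i * g) p) <= n)%N.
    by rewrite -ltnS -szp Pdiv.Ring.ltn_rmodpN0 // monic_neq0.
  have rt : root (map_poly intr p) (rs`_j : K).
    by rewrite pE root_prod_XsubC mem_nth.
  have := congr1 (fun q : {poly int} => (map_poly intr q : {poly K}).[rs`_j])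
    (Pdiv.RingMonic.rdivp_eq mp ('X^i * g)).
  rewrite /= rmorphD !rmorphM /= !hornerE map_polyXn hornerXn (rootP rt) mulr0 add0r => ->.
  rewrite (@horner_coef_wide _ n (map_poly _ _)); last exact: leq_trans (size_poly _ _) szr.
  by apply: eq_bigr => l _; rewrite !mxE coef_map.
have detV : \det (Vandermonde n v) != 0.
  rewrite det_Vandermonde; apply/prodf_neq0 => i _; apply/prodf_neq0 => j ij.
  by rewrite !mxE subr_eq0 nth_uniq // gtn_eqF.
exists (\det A); apply: (mulIf detV).
rewrite -det_map_mx -det_mulmx AV det_mulmx mulrC; congr (_ * _).
rewrite det_diag (big_nth 0) big_mkord; apply: eq_bigr => j _.
by rewrite !mxE.
Qed.

Lemma norm_horner_le (K : numFieldType) (g : {poly int}) (z : K) :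
  `|z| <= 1 -> `|(map_poly intr g).[z]| <= (\sum_(i < size g) `|g`_i|)%:~R.
Proof.
move=> z1; rewrite (@horner_coef_wide _ (size g)) ?size_poly //.
rewrite rmorph_sum /=; apply: (le_trans (ler_norm_sum _ _ _)).
apply: ler_sum => i _; rewrite coef_map normrM normrX -intr_norm.
by rewrite ler_piMr ?exprn_ile1 // ler0z.
Qed.

(** The product of the values of [g] at all conjugates of [beta] is an integer, nonzero because [g]
    vanishes at none of them. Each conjugate other than [beta] lies in the closed unit disk and
    contributes at most the sum of the |g_i|; [d] is the number of these conjugates. *)
Lemma pisot_salem_liouville (R : realType) (beta : R) :
  Pisot beta \/ Salem beta ->
  exists d : nat, forall g : {poly int}, (map_poly intr g).[beta] != 0 ->
    1 <= `|(map_poly intr g).[beta]| * (\sum_(i < size g) `|g`_i|)%:~R ^+ d.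
Proof.
move=> hb.
have [bint conj1] : algebraic_integer beta /\
    forall z : R[i], conjugate_of (real_complex R beta) z ->
      z <> real_complex R beta -> `|z| <= 1.
  by case: hb => [[? _ h]|[? _ h _]]; split => // z cz zb; apply/ltW/h.
pose b := real_complex R beta.
have /minpoly_int [p mp [pm irp rp]] : algebraic_integer b.
  case: bint => q mq rq; exists q => //.
  have -> : map_poly (intr : int -> R[i]) q
      = map_poly (real_complex R) (map_poly intr q).
    by rewrite -map_poly_comp; apply: eq_map_poly => x /=; rewrite rmorph_int.
  by rewrite fmorph_root.
have mapE (q : {poly int}) : map_poly (ratr : rat -> R[i]) (map_poly intr q)
   = map_poly intr q.
  by rewrite -map_poly_comp (eq_map_poly (fun x : int => ratr_int _ x)).
have [rs rsE] := closed_field_poly_normal (map_poly (intr : int -> R[i]) p).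
rewrite (monicP (monic_map _ mp)) scale1r in rsE.
have urs : uniq rs.
  rewrite -separable_prod_XsubC -rsE -mapE separable_map.
  exact: irreducible_separable.
have brs : b \in rs by rewrite -root_prod_XsubC -rsE -mapE.
exists (size (rem b rs)) => g gb.
have gbE : (map_poly intr g).[b] = real_complex R (map_poly intr g).[beta].
  rewrite -horner_map -map_poly_comp; congr (_.[_]).
  by apply: eq_map_poly => x /=; rewrite rmorph_int.
(* A common root with the irreducible [p] would make [p] divide [g], and then [g] would vanish at
   [beta] too. *)
have g0 z : z \in rs -> (map_poly intr g).[z] != 0.
  move=> zrs; apply/negP => gz.
  have rz : root (map_poly intr p) z by rewrite rsE root_prod_XsubC.
  have : map_poly intr p %| (map_poly intr g : {poly rat}).
    apply/idPn; rewrite -irreducible_poly_coprime //.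
    rewrite -(coprimep_map (ratr : {rmorphism rat -> R[i]})).
    move/coprimep_root; rewrite !mapE => /(_ _ rz).
    by rewrite gz.
  rewrite -(dvdp_map (ratr : {rmorphism rat -> R[i]})) !mapE => /dvdpP[q qE].
  have : (map_poly intr g).[b] = 0.
    by move: rp; rewrite mapE qE hornerM => /rootP ->; rewrite mulr0.
  by rewrite gbE => -[] /eqP; rewrite (negbTE gb).
have [k kE] := prod_horner_roots_int g mp urs rsE.
have k1 : 1 <= `|k%:~R : R[i]|.
  rewrite -intr_norm ler1z.
  have k0 : k != 0.
    by rewrite -(intr_eq0 R[i]) kE prodf_seq_neq0; apply/allP => z /g0.
  by rewrite -gtz0_ge1 normr_gt0.
rewrite -lecR rmorph1 rmorphM rmorphXn /= rmorph_int.

have -> : real_complex R `|(map_poly intr g).[beta]| = `|(map_poly intr g).[b]|.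
  by rewrite gbE normc_def /= expr0n addr0 sqrtr_sqr.
apply: (le_trans k1); rewrite kE normr_prod (big_rem b) //=.
rewrite ler_wpM2l // -iter_mulr_1 -count_predT -big_const_seq.
rewrite big_seq [leRHS]big_seq.
apply: ler_prod => z zi; rewrite normr_ge0 /=; apply: norm_horner_le.
(* The roots are distinct, so those left after removing [b] differ from [beta]. *)
apply: conj1; last first.
  by move=> zb; move: zi; rewrite zb mem_rem_uniqF.
exists (map_poly intr p) => //.
by rewrite mapE rsE root_prod_XsubC (mem_rem zi).
Qed.

(** * Supports and masses of polynomials with natural coefficients *)

(* Coefficients in nat make nonnegativity automatic: the support of a product is the
   sumset of the supports, and [mass] is submultiplicative. *)
Definition natcoef (p : {poly nat}) (m : nat) : nat := (p`_m)%R.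

Definition mass (X : nat) (p : {poly nat}) : nat := (\sum_(m < X) natcoef p m)%N.

Definition sub_supp (p q : {poly nat}) : Prop :=
  forall m, (0 < natcoef p m)%N -> (0 < natcoef q m)%N.

Definition le_coef (p q : {poly nat}) : Prop := forall m, (natcoef p m <= natcoef q m)%N.

(** Truncation of one of the series, as a polynomial in theta. Values of [w] may repeat; the
    coefficients of equal exponents add up. *)
Definition expsum (a b : nat) (c w : nat -> nat) : {poly nat} :=
  \sum_(a <= n < b) 'X^(w n) *+ c n.

Lemma coefM_nat (p q : {poly nat}) m :
  natcoef (p * q)%R m = (\sum_(i < m.+1) natcoef p i * natcoef q (m - i))%N.
Proof. exact: coefM. Qed.

Lemma coefM_gt0 (p q : {poly nat}) m :
  (0 < natcoef (p * q)%R m)%N <->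
  exists i j, [/\ (i + j)%N = m, (0 < natcoef p i)%N & (0 < natcoef q j)%N].
Proof.
rewrite coefM_nat; split.
  rewrite lt0n sum_nat_eq0 negb_forall => /existsP[i /=].
  rewrite -lt0n muln_gt0 => /andP[pi qi].
  by exists i, (m - i)%N; split => //; rewrite subnKC // -ltnS.
move=> [i [j [<- pi qj]]].
have im : (i < (i + j).+1)%N by rewrite ltnS leq_addr.
by rewrite (bigD1 (Ordinal im)) //= addn_gt0 addKn muln_gt0 pi qj.
Qed.

Lemma sub_supp_refl p : sub_supp p p. Proof. by []. Qed.

Lemma sub_supp_trans q p r : sub_supp p q -> sub_supp q r -> sub_supp p r.
Proof. by move=> pq qr m /pq /qr. Qed.

Lemma sub_suppM p q p' q' :
  sub_supp p p' -> sub_supp q q' -> sub_supp (p * q) (p' * q').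
Proof.
move=> pp qq m /coefM_gt0[i [j [ij /pp pi /qq qj]]].
by apply/coefM_gt0; exists i, j.
Qed.

Lemma sub_suppX p q n : sub_supp p q -> sub_supp (p ^+ n) (q ^+ n).
Proof.
move=> pq; elim: n => [|n IH]; first by rewrite !expr0.
by rewrite !exprS; apply: sub_suppM.
Qed.

Lemma coefD_nat (p q : {poly nat}) m : natcoef (p + q)%R m = (natcoef p m + natcoef q m)%N.
Proof. exact: coefD. Qed.

Lemma coefMn_nat (p : {poly nat}) n m : natcoef (p *+ n) m = (natcoef p m * n)%N.
Proof. by rewrite /natcoef coefMn -mulr_natr natn. Qed.

Lemma sub_suppDl p q r : sub_supp p q -> sub_supp p (q + r).
Proof. by move=> pq m /pq h; rewrite coefD_nat addn_gt0 h. Qed.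

Lemma sub_suppDr p q r : sub_supp p r -> sub_supp p (q + r).
Proof. by rewrite addrC; apply: sub_suppDl. Qed.

Lemma sub_suppD p q r : sub_supp p r -> sub_supp q r -> sub_supp (p + q) r.
Proof. by move=> pr qr m; rewrite coefD_nat addn_gt0 => /orP[/pr|/qr]. Qed.

Lemma sub_supp0 q : sub_supp 0 q.
Proof. by move=> m; rewrite /natcoef coef0. Qed.

Lemma sub_supp_add1X p i j : (i <= j)%N -> sub_supp ((1 + p) ^+ i) ((1 + p) ^+ j).
Proof.
move=> ij; rewrite -(subnK ij) exprD -{1}[_ ^+ i]mul1r.
apply: sub_suppM => //.
have := @sub_suppX 1 (1 + p) (j - i)%N; rewrite expr1n; apply.
exact: sub_suppDl.
Qed.

Lemma le_coefM p q p' q' :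
  le_coef p p' -> le_coef q q' -> le_coef (p * q) (p' * q').
Proof.
move=> pp qq m; rewrite !coefM_nat; apply: leq_sum => i _.
exact: leq_mul.
Qed.

Lemma le_coefX p q n : le_coef p q -> le_coef (p ^+ n) (q ^+ n).
Proof.
move=> pq; elim: n => [|n IH]; first by rewrite !expr0.
by rewrite !exprS; apply: le_coefM.
Qed.

Lemma le_coef_supp p q : le_coef p q -> sub_supp p q.
Proof. by move=> pq m /leq_trans; apply. Qed.

Lemma mass_add X p q : mass X (p + q) = (mass X p + mass X q)%N.
Proof.
by rewrite /mass -big_split; apply: eq_bigr => i _; rewrite coefD_nat.
Qed.

(** Exponents below [X] in the product come from exponents below [X] in both factors, and each
    product of two coefficients goes to a single exponent. *)
Lemma mass_mul X p q : (mass X (p * q) <= mass X p * mass X q)%N.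
Proof.
have coefM_le (m : 'I_X) : (natcoef (p * q)%R m <=
    \sum_(i < X) \sum_(j < X) natcoef p i * natcoef q j * ((i + j)%N == m))%N.
  rewrite coefM_nat (big_ord_widen X (fun i => natcoef p i * natcoef q (m - i))%N) //.
  rewrite big_mkcond /=; apply: leq_sum => i _; case: ifP => // im.
  have jX : (m - i < X)%N by rewrite (leq_ltn_trans (leq_subr _ _)).
  by rewrite (bigD1 (Ordinal jX)) //= subnKC // eqxx muln1 leq_addr.
apply: (@leq_trans (\sum_(m < X) \sum_(i < X) \sum_(j < X)
    natcoef p i * natcoef q j * ((i + j)%N == m))%N); first exact: leq_sum.
rewrite exchange_big /mass big_distrlr /=; apply: leq_sum => i _.
rewrite exchange_big; apply: leq_sum => j _ /=.
rewrite -big_distrr -[leqRHS]muln1 leq_mul2l /=; apply/orP; right.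
have [ijX|Xij] := ltnP (i + j) X.
  rewrite (bigD1 (Ordinal ijX)) //= eqxx big1 // => m.
  by rewrite eq_sym -val_eqE /= => /negbTE ->.
by rewrite big1 // => m _; rewrite gtn_eqF // (leq_trans (ltn_ord m)).
Qed.

Lemma mass_exp X p n : (mass X (p ^+ n) <= mass X p ^ n)%N.
Proof.
elim: n => [|n IH].
  rewrite expr0 expn0 /mass; under eq_bigr do rewrite /natcoef coef1.
  case: X => [|X]; first by rewrite big_ord0.
  by rewrite big_ord_recl big1.
rewrite exprS expnS; apply: leq_trans (mass_mul _ _ _) _.
by rewrite leq_mul2l IH orbT.
Qed.

Lemma mass1 X : (mass X 1 <= 1)%N.
Proof. by have := mass_exp X 0 0; rewrite expr0 expn0. Qed.

Lemma le_mass X p q : le_coef p q -> (mass X p <= mass X q)%N.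
Proof. by move=> pq; apply: leq_sum => i _. Qed.

Lemma coef_expsum a b c w m :
  natcoef (expsum a b c w) m = (\sum_(a <= n < b) c n * (m == w n))%N.
Proof.
rewrite /natcoef /expsum coef_sum; apply: eq_bigr => n _.
rewrite coefMn coefXn; case: eqP => _; last by rewrite mul0rn muln0.
by rewrite muln1 natn.
Qed.

Lemma expsum_gt0P a b c w m :
  (0 < natcoef (expsum a b c w) m)%N <->
  exists n, [/\ (a <= n < b)%N, (0 < c n)%N & w n = m].
Proof.
rewrite coef_expsum big_nat_cond lt0n sum_nat_seq_neq0; split.
  move=> /hasP[n _ /andP[]]; rewrite andbT => ab.
  by rewrite -lt0n muln_gt0 lt0b => /andP[cn /eqP ->]; exists n.
move=> [n [ab cn wn]]; apply/hasP; exists n; first by rewrite mem_index_iota.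
by rewrite ab wn eqxx muln1 -lt0n cn.
Qed.

Lemma expsum_cat b a d c w : (a <= b <= d)%N ->
  expsum a d c w = expsum a b c w + expsum b d c w.
Proof. by move=> /andP[ab bd]; rewrite /expsum (big_cat_nat ab bd). Qed.

(** Only indices below [y] can have exponents below [X], and each of them contributes its
    coefficient at most once. *)
Lemma mass_expsum X y a b c w : (forall n, (a <= n)%N -> (y <= n)%N -> (X <= w n)%N) ->
  (mass X (expsum a b c w) <= \sum_(n < y) c n)%N.
Proof.
move=> hy; rewrite /mass; under eq_bigr do rewrite coef_expsum.
rewrite exchange_big /=.
apply: (@leq_trans (\sum_(a <= n < b | (n < y)%N) c n)).
  rewrite [leqRHS]big_mkcond /= big_nat_cond [leqRHS]big_nat_cond.
  apply: leq_sum => n /andP[/andP[an _] _].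
  rewrite -big_distrr /=.
  have [ny|yn] := ltnP n y.
    rewrite -[leqRHS]muln1 leq_mul2l; apply/orP; right.
    rewrite -(big_mkord predT (fun i => nat_of_bool (i == w n))).
    have [wX|Xw] := ltnP (w n) X.
      rewrite (bigD1_seq (w n)) ?mem_index_iota ?iota_uniq //= eqxx.
      by rewrite big1 // => i /negbTE ->.
    by rewrite big_nat big1 // => i /andP[_ iX]; rewrite ltn_eqF // (leq_trans iX).
  rewrite big1 ?muln0 // => i _.
  by rewrite ltn_eqF // (leq_trans (ltn_ord i)) // hy.
rewrite big_geq_mkord.
rewrite (big_ord_widen_cond (maxn b y) (fun n => (n < y)%N && (a <= n)%N) c) ?leq_maxl //.
rewrite (big_ord_widen (maxn b y) c) ?leq_maxr // big_mkcond [leqRHS]big_mkcond /=.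
by apply: leq_sum => n _; case: (n < y)%N => //=; case: ifP.
Qed.

(** * Sign of the coefficients of a relation *)

Definition monomial (F1 F2 F3 : {poly nat}) (k : nat * nat * nat) : {poly nat} :=
  F1 ^+ k.1.1 * F2 ^+ k.1.2 * F3 ^+ k.2.

(** When the product is expanded, every term except [h1 ^+ a * h2 ^+ b] contains a factor [s1] or
    [s2], supported in [Hs], and [e] further factors, supported in [Hs + H]. *)
Lemma monomial_tail (s1 s2 h1 h2 Hs H : {poly nat}) a b e :
  sub_supp s1 Hs -> sub_supp s2 Hs -> sub_supp h1 H -> sub_supp h2 H ->
  (a + b = e.+1)%N ->
  exists2 r, (s1 + h1) ^+ a * (s2 + h2) ^+ b = h1 ^+ a * h2 ^+ b + r &
    sub_supp r (Hs * (1 + (Hs + H)) ^+ e).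
Proof.
move=> s1H s2H h1H h2H abe; set W := 1 + (Hs + H).
(* [p] is a product of [j] factors [s + h] and [p'] the corresponding product of the [h]. The clause
   for [j = 0] is there because [j.-1] is then 0 as well, although no factor [Hs] has appeared. *)
pose Q j p p' := exists r, [/\ p = p' + r, j = 0%N -> r = 0,
  sub_supp r (Hs * W ^+ j.-1) & sub_supp p (W ^+ j)].
have step s h j p p' : sub_supp s Hs -> sub_supp h H -> Q j p p' ->
    Q j.+1 ((s + h) * p) (h * p').
  move=> sH hH [r [-> r0 rS pS]]; exists (s * (p' + r) + h * r); split => //=.
  - by rewrite mulrDl mulrDr [h * _]mulrDr; ring.
  - apply: sub_suppD; first exact: sub_suppM.
    case: j => [|j] in r0 rS pS *; first by rewrite r0 // mulr0; exact: sub_supp0.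
    apply: (@sub_supp_trans (W * (Hs * W ^+ j))).
      by apply: sub_suppM rS; do 2 apply: sub_suppDr.
    by rewrite exprS mulrCA.
  - rewrite exprS; apply: sub_suppM => //; apply: sub_suppD; apply: sub_suppDr.
      exact: sub_suppDl.
    exact: sub_suppDr.
have Q0 : Q 0%N 1 1.
  by exists 0; split => //; [rewrite addr0|exact: sub_supp0].
have Qb : Q b ((s2 + h2) ^+ b) (h2 ^+ b).
  elim: (b) => [|j IH]; first by rewrite !expr0.
  by rewrite !exprS; apply: step.
have [r [-> _ rS _]] : Q (a + b)%N ((s1 + h1) ^+ a * (s2 + h2) ^+ b) (h1 ^+ a * h2 ^+ b).
  elim: (a) => [|j IH]; first by rewrite !expr0 !mul1r.
  by rewrite !exprS -!mulrA; apply: step.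
by exists r => //; move: rS; rewrite abe.
Qed.

(* The first vanishing hypothesis discards the monomials of degree at most [e] in
   (X1, X2) and the contributions of the indices below the threshold; the second one
   discards those of degree at most [c] in X3.  Among the others, the domination
   [h2 *+ KK <= h1] makes the largest power of X1 prevail. *)
Lemma coef_sign (ks : seq (nat * nat * nat)) (A : nat * nat * nat -> int)
    (top : nat * nat * nat) (s1 s2 h1 h2 F3 Hs H V : {poly nat}) (e c D KK : nat) :
  sub_supp s1 Hs -> sub_supp s2 Hs -> sub_supp h1 H -> sub_supp h2 H ->
  sub_supp H h2 -> sub_supp F3 V -> sub_supp V F3 ->
  le_coef (h2 *+ KK) h1 ->
  uniq ks -> top \in ks ->
  (top.1.1 + top.1.2 = e.+1)%N -> top.2 = c.+1 ->
  (forall k, k \in ks -> (k.1.1 + k.1.2 <= e.+1)%N /\ (k.2 <= D)%N) ->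
  (forall k, k \in ks -> (k.1.1 + k.1.2 = e.+1)%N -> (k.2 <= c.+1)%N) ->
  (forall k, k \in ks -> (k.1.1 + k.1.2 = e.+1)%N -> k.2 = c.+1 ->
     (k.1.1 <= top.1.1)%N) ->
  0 < A top -> \sum_(k <- ks) `|A k| < KK%:Z ->
  let G m := \sum_(k <- ks) A k * (natcoef (monomial (s1 + h1) (s2 + h2) F3 k) m)%:Z in
  forall m, natcoef ((1 + Hs) * (1 + (Hs + H)) ^+ e * (1 + V) ^+ D) m = 0%N ->
    natcoef (H ^+ e.+1 * (1 + V) ^+ c) m = 0%N ->
    0 <= G m /\ ((0 < natcoef (H ^+ e.+1 * V ^+ c.+1) m)%N -> 0 < G m).
Proof.
move=> s1H s2H h1H h2H Hh2 F3V VF3 KKh uks tks tope topc kse ksc ksa At AKK G m B0 T0.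
set W := 1 + (Hs + H) in B0.
have KK0 : (0 < KK)%N.
  by rewrite -ltz_nat (le_lt_trans _ AKK) // sumr_ge0.
have h2h1 : le_coef h2 h1.
  move=> i; apply: leq_trans (KKh i).
  by rewrite coefMn_nat leq_pmulr.
have zero p : sub_supp p ((1 + Hs) * W ^+ e * (1 + V) ^+ D) -> natcoef p m = 0%N.
  by move=> /(_ m); rewrite B0; case: (natcoef p m) => // n /(_ isT).
pose M := monomial h1 h2 F3 top.
have monoE k : k \in ks -> (k.1.1 + k.1.2 = e.+1)%N ->
    natcoef (monomial (s1 + h1) (s2 + h2) F3 k) m = natcoef (monomial h1 h2 F3 k) m.
  move=> kks ke; have [_ kD] := kse k kks.
  have [r rE rS] := monomial_tail s1H s2H h1H h2H ke.
  rewrite /monomial rE mulrDl coefD_nat [X in (_ + X)%N]zero ?addn0 //.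
  apply: sub_suppM.
    apply: sub_supp_trans rS _; apply: sub_suppM => //; exact: sub_suppDr.
  apply: sub_supp_trans _ (sub_supp_add1X kD); apply: sub_suppX.
  exact: sub_suppDr.
(* Monomials of lower degree in (X1, X2), or of top degree there but lower degree in X3, have
   coefficient 0 at [m]. The remaining ones differ from the top one by exchanges of [h1] for
   [h2]. *)
have other k : k \in ks -> k != top ->
    (natcoef (monomial (s1 + h1) (s2 + h2) F3 k) m * KK <= natcoef M m)%N.
  move=> kks kt; have [ke kD] := kse k kks.
  have FV j : sub_supp (F3 ^+ j) ((1 + V) ^+ j).
    by apply: sub_suppX; apply: sub_suppDr.
  have [ke'|ke'] := ltnP (k.1.1 + k.1.2)%N e.+1.
    rewrite zero //; apply: sub_suppM; last first.
      exact: sub_supp_trans (FV _) (sub_supp_add1X kD).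
    rewrite -[X in sub_supp X](mul1r (_ * _)).
    apply: sub_suppM; first exact: sub_suppDl.
    apply: sub_supp_trans _ (sub_supp_add1X (ke' : (_ <= e)%N)).
    rewrite exprD; apply: sub_suppM; apply: sub_suppX; apply: sub_suppD; apply: sub_suppDr.
    - exact: sub_suppDl.
    - exact: sub_suppDr.
    - exact: sub_suppDl.
    - exact: sub_suppDr.
  have {ke ke'} ke : (k.1.1 + k.1.2 = e.+1)%N by apply/eqP; rewrite eqn_leq ke.
  rewrite monoE //; have := ksc k kks ke; rewrite leq_eqVlt => /orP[/eqP kc|kc].
    have ka := ksa k kks ke kc.
    have {}ka : (k.1.1 < top.1.1)%N.
      rewrite ltn_neqAle ka andbT; apply: contraNneq kt => ka'.
      have kb : k.1.2 = top.1.2 by apply: (@addnI k.1.1); rewrite ke ka' tope.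
      case: (k) (top) ka' kb kc topc => [[? ?] ?] [[? ?] ?] /= -> -> -> ->.
      by rewrite eqxx.
    (* The top monomial has [d.+1] factors [h1] where this one has [h2]: one exchange gains the
       factor [KK], the others use [h2h1]. *)
    have kaE : top.1.1 = (k.1.1 + (top.1.1 - k.1.1).-1.+1)%N by lia.
    have kbE : k.1.2 = ((top.1.1 - k.1.1).-1.+1 + top.1.2)%N by lia.
    rewrite /M /monomial topc kc {1}kaE {1}kbE; set d := (_.-1).
    have -> : (natcoef (h1 ^+ k.1.1 * h2 ^+ (d.+1 + top.1.2) * F3 ^+ c.+1)%R m * KK)%N =
        natcoef (h1 ^+ k.1.1 * ((h2 *+ KK) * h2 ^+ d * h2 ^+ top.1.2) * F3 ^+ c.+1) m.
      by rewrite -coefMn_nat; congr (natcoef _ m); rewrite exprD exprS; ring.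
    rewrite (exprD h1) (exprS h1).
    rewrite -[X in (_ <= natcoef (X * _) _)%N]mulrA.
    apply: le_coefM => //; apply: le_coefM => //; apply: le_coefM => //.
    by apply: le_coefM => //; apply: le_coefX.
  have : natcoef (monomial h1 h2 F3 k) m = 0%N.
    have : sub_supp (monomial h1 h2 F3 k) (H ^+ e.+1 * (1 + V) ^+ c).
      apply: sub_suppM; last exact: sub_supp_trans (FV _) (sub_supp_add1X (kc : (_ <= c)%N)).
      by rewrite -ke exprD; apply: sub_suppM; apply: sub_suppX.
    by move=> /(_ m); rewrite T0; case: (natcoef _ m) => // n /(_ isT).
  by move=> ->.
(* Since [A top >= 1] and the other |A k| add up to less than [KK], the difference of [A top * KK]
   and that sum is at least 1. *)
have GM : (natcoef M m)%:Z <= G m * KK%:Z.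
  rewrite /G (bigD1_seq top) //= monoE // -/M mulrDl big_seq_cond mulr_suml.
  have S1 : - \sum_(k <- ks | k != top) `|A k| * (natcoef M m)%:Z <=
     \sum_(i <- ks | (i \in ks) && (i != top))
       A i * (natcoef (monomial (s1 + h1) (s2 + h2) F3 i) m)%:Z * KK%:Z.
    rewrite -sumrN [leLHS]big_seq_cond; apply: ler_sum => k /andP[kks kt].
    have := other k kks kt; set x := natcoef _ m; set y := natcoef M m => xy.
    rewrite -mulrA -PoszM lerNl -mulNr.
    apply: (@le_trans _ _ (`|A k| * (x * KK)%N%:Z)).
      by apply: ler_wpM2r => //; rewrite -normrN ler_norm.
    by apply: ler_wpM2l.
  apply: le_trans (lerD (lexx _) S1).
  rewrite -mulr_suml -mulrA [_%:Z * KK%:Z]mulrC mulrA -mulrBl.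
  rewrite -[leLHS]mul1r; apply: ler_wpM2r => //.
  have : KK%:Z <= A top * KK%:Z by rewrite ler_peMl // -gtz0_ge1.
  move: AKK; rewrite (bigD1_seq top) //=.
  move=> S2 S3; rewrite -gtz0_ge1 subr_gt0 (lt_le_trans _ S3) //.
  by apply: le_lt_trans S2; rewrite lerDr.
have KKz : 0 < KK%:Z by rewrite ltz_nat.
split; first by rewrite -(pmulr_lge0 _ KKz) (le_trans _ GM).
move=> HV; rewrite -(pmulr_lgt0 _ KKz) (lt_le_trans _ GM) // ltz_nat.
have : sub_supp (H ^+ e.+1 * V ^+ c.+1) M.
  rewrite /M /monomial topc; apply: sub_suppM; last exact: sub_suppX.
  rewrite -tope exprD; apply: sub_suppM; apply: sub_suppX => //.
  exact: sub_supp_trans Hh2 (le_coef_supp h2h1).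
exact.
Qed.

(** * Counting, gaps and isolated positive coefficients *)

Definition count_in (P : pred nat) (a b : nat) : nat := (\sum_(a <= m < b) P m)%N.

Lemma count_in_cat (P : pred nat) a b c : (a <= b <= c)%N ->
  count_in P a c = (count_in P a b + count_in P b c)%N.
Proof. by move=> /andP[ab bc]; rewrite /count_in (big_cat_nat ab bc). Qed.

Lemma le_count_in (P : pred nat) a b a' b' : (a' <= a)%N -> (b <= b')%N ->
  (count_in P a b <= count_in P a' b')%N.
Proof.
move=> aa bb; have [ab|ba] := leqP a b; last by rewrite /count_in big_geq // ltnW.
rewrite (@count_in_cat P a' b b') ?(leq_trans aa) // (@count_in_cat P a' a b) ?aa //.
by rewrite -addnA addnCA leq_addr.
Qed.

Lemma count_in_gt0 (P : pred nat) a b m : P m -> (a <= m < b)%N -> (0 < count_in P a b)%N.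
Proof.
move=> Pm /andP[am mb]; apply: (@leq_trans (count_in P m m.+1)); last exact: le_count_in.
by rewrite /count_in big_nat1 Pm.
Qed.

Lemma count_in_mass (p : {poly nat}) X : (count_in (fun m => 0 < natcoef p m)%N 0 X <= mass X p)%N.
Proof.
rewrite /count_in /mass big_mkord; apply: leq_sum => i _.
by case: (natcoef p i).
Qed.

Lemma count_in_windows (P : pred nat) (x : nat -> nat) om n :
  (forall i, (i < n)%N -> (x i + om <= x i.+1)%N) ->
  (x 0 <= x n)%N /\ (\sum_(i < n) count_in P (x i) (x i + om) <= count_in P (x 0) (x n))%N.
Proof.
elim: n => [|n IH] hx; first by rewrite big_ord0.
have [x0n IHn] := IH (fun i im => hx i (leqW im)).
have xn : (x n <= x n.+1)%N by apply: leq_trans (hx n (ltnSn n)); rewrite leq_addr.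
split; first exact: leq_trans xn.
rewrite big_ord_recr /= (@count_in_cat P (x 0%N) (x n)) ?x0n //.
by apply: leq_add => //; apply: le_count_in => //; apply: hx.
Qed.

(** Jump from [s] to a later element at distance at most [L] as long as there is one. Each jump uses
    up one of the fewer than [q] elements of the range, so the jumps end at an element followed by a
    gap. *)
Lemma long_gap_right (P : pred nat) (q L s : nat) :
  P s -> (count_in P s.+1 (s + q * L).+1 < q)%N ->
  exists p, [/\ (s <= p)%N, P p, (p + L <= s + q * L)%N &
    forall m, (p < m <= p + L)%N -> ~~ P m].
Proof.
elim: q s => [//|q IH] s Ps cs.
have [/existsP[i Pi]|/existsPn no] := boolP [exists i : 'I_L, P (s + i.+1)%N]; last first.
  exists s; split => //; first by rewrite mulSn leq_add2l leq_addr.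
  move=> m /andP[sm mL]; have mL' : (m - s.+1 < L)%N by lia.
  by have := no (Ordinal mL'); rewrite /= (_ : (s + _ = m)%N) //; lia.
have iL := ltn_ord i; set m := (s + i.+1)%N in Pi.
have mq : (m + q * L <= s + q.+1 * L)%N by rewrite mulSn /m; lia.
have [p [mp Pp pL gap]] : exists p, [/\ (m <= p)%N, P p, (p + L <= m + q * L)%N &
    forall m, (p < m <= p + L)%N -> ~~ P m].
  apply: IH => //; rewrite -ltnS; apply: leq_trans cs.
  rewrite ltnS (@count_in_cat P s.+1 m.+1 (s + q.+1 * L).+1); last by rewrite /m; lia.
  rewrite -add1n; apply: leq_add; last exact: le_count_in.
  by apply: (@count_in_gt0 _ _ _ m) => //; rewrite /m; lia.
by exists p; split => //; [apply: leq_trans mp; rewrite /m leq_addr | exact: leq_trans mq].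
Qed.

(** The same jumps to the left; [q * L <= s] keeps the subtractions from being truncated. *)
Lemma long_gap_left (P : pred nat) (q L s : nat) :
  P s -> (q * L <= s)%N -> (count_in P (s - q * L) s < q)%N ->
  exists p, [/\ (p <= s)%N, P p, (s - q * L + L <= p)%N &
    forall m, (p - L <= m < p)%N -> ~~ P m].
Proof.
elim: q s => [//|q IH] s Ps qLs cs.
have [/existsP[i Pi]|/existsPn no] := boolP [exists i : 'I_L, P (s - i.+1)%N]; last first.
  exists s; split => //; first by move: qLs; rewrite mulSn; lia.
  move=> m /andP[sm mL]; have mL' : (s - m.+1 < L)%N.
    by move: qLs; rewrite mulSn; lia.
  by have := no (Ordinal mL'); rewrite /= (_ : (s - _ = m)%N) //; lia.
have iL := ltn_ord i; set m := (s - i.+1)%N in Pi.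
have mq : (s - q.+1 * L <= m - q * L)%N by move: qLs; rewrite mulSn /m; lia.
have qm : (q * L <= m)%N by move: qLs; rewrite mulSn /m; lia.
have ms : (m < s)%N by move: qLs; rewrite mulSn /m; lia.
have [p [mp Pp pL gap]] : exists p, [/\ (p <= m)%N, P p, (m - q * L + L <= p)%N &
    forall m, (p - L <= m < p)%N -> ~~ P m].
  apply: IH => //; rewrite -ltnS; apply: leq_trans cs.
  rewrite ltnS (@count_in_cat P (s - q.+1 * L) m s); last by lia.
  rewrite -addn1; apply: leq_add; first exact: le_count_in.
  by apply: (@count_in_gt0 _ _ _ m) => //; lia.
by exists p; split => //; lia.
Qed.

(* Blocks of indices of very different sizes make the sums of [e] values of [w]
   pairwise distant; the pigeonhole principle selects the indices one block at a
   time, the largest first. *)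
Lemma box_sum_avoiding (P : pred nat) (H : {poly nat}) (w om : nat -> nat) (K r e p : nat) :
  (0 < K)%N -> (forall j, om j = w (2 * K ^ j)%N) ->
  (forall j n, (r <= j < r + e)%N -> (K ^ j.+1 <= n < 2 * K ^ j.+1)%N ->
     (w n + om j <= w n.+1)%N /\ (0 < natcoef H (w n))%N) ->
  (count_in P p (p + om (r + e)) < (K ^ r.+1) ^ e)%N ->
  exists sg, [/\ (0 < natcoef (H ^+ e) sg)%N, (sg + om r <= om (r + e))%N &
    forall m, (p + sg <= m < p + sg + om r)%N -> ~~ P m].
Proof.
move=> K0 omE; elim: e p => [|e IH] p hw hc.
  exists 0%N; rewrite expr0 addn0 add0n; split => //.
    by rewrite /natcoef coef1.
  move=> m hm; apply/negP => Pm; move: hc; rewrite expn0 addn0.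
  by apply/negP; rewrite -leqNgt; apply: (count_in_gt0 Pm); rewrite -{1 2}(addn0 p).
pose k := (K ^ (r + e).+1)%N; pose x i := (p + w (k + i))%N.
have hx i : (i < k)%N -> (x i + om (r + e) <= x i.+1)%N.
  move=> ik; rewrite /x -addnA leq_add2l addnS; apply: (hw _ _ _ _).1; first by lia.
  by rewrite -/k leq_addr /=; lia.
have [_ S1] := count_in_windows P hx.
(* Pigeonhole: there are [k >= K ^ r.+1] disjoint windows with fewer than [(K ^ r.+1) ^ e.+1]
   elements of [P] in all. *)
have [i hi] : exists i : 'I_k, (count_in P (x i) (x i + om (r + e)) < (K ^ r.+1) ^ e)%N.
  apply/existsP; apply: contraLR hc => /existsPn no; rewrite -leqNgt.
  apply: (@leq_trans (\sum_(i < k) (K ^ r.+1) ^ e)).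
    rewrite sum_nat_const card_ord expnS leq_mul2r; apply/orP; right.
        by rewrite leq_pexp2l // ltnS leq_addr.
  apply: (@leq_trans (\sum_(i < k) count_in P (x i) (x i + om (r + e)))).
    by apply: leq_sum => i _; rewrite leqNgt; apply: no.
  apply: leq_trans S1 _; apply: le_count_in; rewrite /x ?leq_addr //.
  by rewrite leq_add2l addnS omE mul2n -addnn.
have ik := ltn_ord i.
have kik : (K ^ (r + e).+1 <= k + i < 2 * K ^ (r + e).+1)%N by rewrite -/k; lia.
have [sg [Hsg sgr free]] := IH (x i) (fun j n hj => hw j n ltac:(lia)) hi.
have [wk Hk] := hw (r + e)%N (k + i)%N ltac:(lia) kik.
exists (w (k + i) + sg)%N; split.
- by rewrite exprS; apply/coefM_gt0; exists (w (k + i)%N), sg.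
- rewrite addnS (omE (r + e).+1) -addnA; apply: (@leq_trans (w (k + i).+1)).
    by apply: leq_trans wk; rewrite leq_add2l.
  (* With windows of width 0, the first conclusion of [count_in_windows] is the monotonicity of [w]
     up to the index [2 * k]. *)
  have hx' j : (j < k - i.+1)%N -> (w ((k + i).+1 + j) + 0 <= w ((k + i).+1 + j.+1))%N.
    move=> jk; rewrite addn0 addnS; apply: leq_trans (hw (r + e)%N _ _ _).1.
    - exact: leq_addr.
    - by lia.
    - by rewrite -/k; lia.
  have [+ _] := @count_in_windows P (fun j => w ((k + i).+1 + j)%N) 0 _ hx'.
  by rewrite addn0 (_ : _ + (k - i.+1) = 2 * k)%N //; lia.
- by move=> m; rewrite !addnA; apply: free.
Qed.

(** A sum of at most [c] values becomes, with one more value, a sum of exactly [c.+1] values or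
    again of at most [c]; a gap will exclude the second alternative. *)
Lemma supp_mul1X (V : {poly nat}) c :
  sub_supp ((1 + V) ^+ c * V) (V ^+ c.+1 + (1 + V) ^+ c).
Proof.
elim: c => [|c IH]; first by rewrite expr0 mul1r expr1; exact: sub_suppDl.
rewrite exprS -mulrA.
apply: sub_supp_trans (sub_suppM (@sub_supp_refl (1 + V)) IH) _.
rewrite mulrDr -exprS mulrDl mul1r -exprS -addrA.
apply: sub_suppD; last exact: sub_supp_refl.
by apply: sub_suppDr; apply: sub_suppX; apply: sub_suppDr.
Qed.

(** Three nested searches: an interval of length [om r] free of the support of [Bd], in it a gap of
    length [L] in the support of [H ^+ e * (1 + V) ^+ c], and in that gap a run of [g] zeros of [G]
    just before a positive coefficient. The inequalities on [q], [L], [g] and [tau] keep each search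
    inside the previous one. *)
Lemma isolated_positive (G : nat -> int) (H V Bd : {poly nat}) (w om : nat -> nat)
    (K r e c q L g tau : nat) :
  (0 < K)%N -> (forall j, om j = w (2 * K ^ j)%N) ->
  (forall j n, (r <= j < r + e)%N -> (K ^ j.+1 <= n < 2 * K ^ j.+1)%N ->
     (w n + om j <= w n.+1)%N /\ (0 < natcoef H (w n))%N) ->
  (forall m, natcoef Bd m = 0%N -> natcoef (H ^+ e * (1 + V) ^+ c) m = 0%N ->
     0 <= G m /\ ((0 < natcoef (H ^+ e * V ^+ c.+1) m)%N -> 0 < G m)) ->
  (mass (om (r + e)%N) Bd < (K ^ r.+1) ^ e)%N ->
  (mass (om (r + e)%N) (H ^+ e * (1 + V) ^+ c) < q)%N ->
  (count_in (fun m => G m != 0) 0 (om (r + e)%N) < q)%N ->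
  (q * L < om r)%N -> (0 < g)%N -> (0 < natcoef V tau)%N -> (q * g <= tau)%N -> (tau + g <= L)%N ->
  exists m, [/\ (g <= m)%N, (m + g < om (r + e))%N, 0 < G m,
     forall i, (m - g <= i < m)%N -> G i = 0 &
     forall i, (m < i <= m + g)%N -> 0 <= G i].
Proof.
move=> K0 omE hw sgn mB mT cG qL g0 Vt qgt tL.
have [sg [Hsg sgO Bfree]] : exists sg, [/\ (0 < natcoef (H ^+ e) sg)%N,
    (sg + om r <= om (r + e))%N &
    forall m, (sg <= m < sg + om r)%N -> ~~ (0 < natcoef Bd m)%N].
  apply: (@box_sum_avoiding _ H w om K r e 0) => //; rewrite add0n.
  by apply: leq_ltn_trans mB; apply: count_in_mass.
pose Th := H ^+ e * (1 + V) ^+ c.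
(* With no value of v added, [sg] itself lies in the second support, so the search to the right can
   start there. *)
have Thsg : (0 < natcoef Th sg)%N.
  apply/coefM_gt0; exists sg, 0%N; rewrite addn0; split => //.
  have := @sub_supp_add1X V 0 c isT 0%N; apply.
  by rewrite expr0 /natcoef coef1.
have [p [sp Tp pL Tfree]] : exists p, [/\ (sg <= p)%N, (0 < natcoef Th p)%N,
    (p + L <= sg + q * L)%N & forall m, (p < m <= p + L)%N -> ~~ (0 < natcoef Th m)%N].
  apply: (@long_gap_right (fun m => 0 < natcoef Th m)%N) => //.
  apply: leq_ltn_trans mT; apply: leq_trans (count_in_mass _ _).
  by apply: le_count_in => //; lia.
have sgn' m : (p < m <= p + L)%N ->
    0 <= G m /\ ((0 < natcoef (H ^+ e * V ^+ c.+1) m)%N -> 0 < G m).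
  move=> pm; apply: sgn; apply/eqP; rewrite -leqn0 leqNgt; last exact: Tfree.
  by apply: Bfree; lia.
have tau0 : (0 < tau)%N.
  have : (0 < q)%N by apply: leq_trans mT.
  by move=> q0; apply: leq_trans qgt; rewrite muln_gt0 q0.
(* [p + tau] lies inside the gap, so of the two alternatives of [supp_mul1X] only the sum with
   [c.+1] values remains. *)
have Gt : 0 < G (p + tau)%N.
  apply: (sgn' _ _).2; first by lia.
  have : (0 < natcoef (H ^+ e * ((1 + V) ^+ c * V)) (p + tau)%N)%N.
    by rewrite mulrA; apply/coefM_gt0; exists p, tau.
  move=> /(sub_suppM (@sub_supp_refl (H ^+ e)) (@supp_mul1X V c)).
  rewrite mulrDr coefD_nat addn_gt0 => /orP[//|].
  by rewrite (negbTE (Tfree _ _)) //; lia.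
(* The search to the left covers a distance [q * g <= tau], so it stays to the right of [p], where
   [G] is nonnegative. *)
have [m [mt Gm tm Gfree]] : exists m, [/\ (m <= p + tau)%N, G m != 0,
   (p + tau - q * g + g <= m)%N & forall i, (m - g <= i < m)%N -> ~~ (G i != 0)].
  apply: (@long_gap_left (fun m => G m != 0)) => //.
  - by rewrite gt_eqF.
  - exact: leq_trans (leq_addl _ _).
  - by apply: leq_ltn_trans cG; apply: le_count_in => //; lia.
exists m; split.
- by lia.
- by lia.
- by rewrite lt_neqAle eq_sym Gm (sgn' _ _).1 //; lia.
- by move=> i im; have := Gfree i im; rewrite negbK => /eqP.
- by move=> i im; apply: (sgn' _ _).1; lia.
Qed.

(** * A gap before a positive coefficient contradicts the Liouville inequality *)

Lemma geometric_sum_le (R : realType) (x : R) n :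
  0 <= x -> x < 1 -> \sum_(i < n) x ^+ i <= (1 - x)^-1.
Proof.
move=> x0 x1; rewrite -[leRHS]mul1r ler_pdivlMr ?subr_gt0 //.
by rewrite mulrC -opprB mulNr -subrX1 opprB lerBlDr lerDl exprn_ge0.
Qed.

Lemma sum_geometric_tail (R : realType) (x : R) a b n :
  0 <= x -> x < 1 -> (a <= b)%N ->
  \sum_(b <= i < n) x ^+ (i - a) <= x ^+ (b - a) * (1 - x)^-1.
Proof.
move=> x0 x1 ab; rewrite -{1}(add0n b) big_addn big_mkord.
rewrite (eq_bigr (fun i : 'I__ => x ^+ (b - a) * x ^+ i)); last first.
  by move=> i _; rewrite -exprD; congr (_ ^+ _); lia.
by rewrite -mulr_sumr ler_wpM2l ?exprn_ge0 // geometric_sum_le.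
Qed.

(* [beta = gam ^ 2]: half of the decay of [beta ^- i] absorbs the growth of [G]. *)
Lemma gap_contradiction (R : realType) (gam : R) (G : {poly int}) (d g m : nat) (B : R) :
  let beta := gam ^+ 2 in
  1 < gam ->
  (forall f : {poly int}, (map_poly intr f).[beta] != 0 ->
     1 <= `|(map_poly intr f).[beta]| * (\sum_(i < size f) `|f`_i|)%:~R ^+ d) ->
  (g <= m)%N -> 0 < G`_m ->
  (forall i, (m - g <= i < m)%N -> G`_i = 0) ->
  (forall i, (m < i <= m + g)%N -> 0 <= G`_i) ->
  (forall i, (m <= i)%N -> `|G`_i|%:~R <= gam ^+ (i - (m - g))) ->
  (forall i, (m + g <= i)%N -> `|G`_i|%:~R <= gam ^+ (i - m)) ->
  (\sum_(i < m - g) `|G`_i|)%:~R <= B -> 1 <= B ->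
  2 * (1 - gam^-1)^-1 * B ^+ d < gam ^+ g ->
  `|(map_poly intr G).[beta^-1]| <= beta ^- m / 4 -> False.
Proof.
move=> beta gam1 liou gm Gm Gzero Gpos tail1 tail2 GB B1 gbig small.
set A := (m - g)%N in Gzero tail1 GB.
have gam0 : 0 < gam by rewrite (lt_trans ltr01).
have b0 : 0 < beta by rewrite exprn_gt0.
have b1 : 1 < beta by rewrite expr_gt1 // ltW.
pose th := beta^-1; pose rho := gam^-1.
have th0 : 0 < th by rewrite invr_gt0.
have rho0 : 0 < rho by rewrite invr_gt0.
have rho1 : rho < 1 by rewrite invf_lt1.
have thE n : th ^+ n = rho ^+ n * rho ^+ n.
  by rewrite /th /beta /rho -exprMn -exprVn expr2.
pose tau := (1 - rho)^-1.
have tau0 : 0 < tau by rewrite invr_gt0 subr_gt0.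
pose n := maxn (size G) (m + g).+1.
have nG : (size (map_poly (intr : int -> R) G) <= n)%N.
  by rewrite (leq_trans (size_poly _ _)) ?leq_maxl.
have mgn : (m + g < n)%N by rewrite leq_maxr.
pose c i : R := (G`_i)%:~R.
pose T := \sum_(m <= i < n) c i * th ^+ (i - A).
(* Reversed coefficients: [f0] is [beta ^+ A] times the part of the sum below [A]. All exponents
   [A - i] are positive, so a factor [beta] splits off and [f] has at most [A] coefficients. *)
pose f := \poly_(i < A) G`_(A.-1 - i).
pose f0 : R := beta * (map_poly intr f).[beta].
have bth : beta * th = 1 by rewrite mulfV // gt_eqF.
have f0E : f0 = \sum_(0 <= i < A) c i * beta ^+ (A - i).
  rewrite /f0 (@horner_coef_wide _ A); last first.
    by apply: leq_trans (size_poly _ _) _; exact: size_poly.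
  rewrite mulr_sumr big_mkord (reindex_inj rev_ord_inj) /=.
  apply: eq_bigr => i _; have := ltn_ord i => iA.
  rewrite coef_map coef_poly ifT; last by move: iA; clear; lia.
  rewrite mulrCA -exprS /c (_ : (A.-1 - (A - i.+1))%N = i); last by move: iA; clear; lia.
  by rewrite (_ : (A - i.+1).+1 = (A - i)%N) //; move: iA; clear; lia.
have GE : beta ^+ A * (map_poly intr G).[th] = f0 + T.
  rewrite (@horner_coef_wide _ n) // mulr_sumr.
  rewrite -(big_mkord predT (fun i => beta ^+ A * ((map_poly intr G)`_i * th ^+ i))).
  rewrite (@big_cat_nat _ _ _ m) ?(leq_trans _ mgn) //=; last by move: mgn; clear; lia.
  rewrite (@big_cat_nat _ _ _ A 0 m) ?leq_subr //=.
  rewrite [X in _ + X + _]big_nat [X in _ + X + _]big1 ?addr0; last first.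
    by move=> i im; rewrite coef_map Gzero //= mul0r mulr0.
  congr (_ + _).
    rewrite f0E; apply: eq_big_nat => i /andP[_ iA].
    rewrite coef_map mulrCA /=; congr (_ * _).
    rewrite -{1}(subnK (ltnW iA)) exprD -mulrA -exprMn bth ?expr1n ?mulr1 //.
  apply: eq_big_nat => i /andP[im _].
  rewrite coef_map mulrCA /=; congr (_ * _).
  have Ai : (A <= i)%N by move: im; rewrite /A; clear; lia.
  by rewrite -{1}(subnKC Ai) exprD mulrA -exprMn bth ?expr1n ?mul1r.
have tgam i j : `|c i| <= gam ^+ j -> `|c i * th ^+ j| <= rho ^+ j.
  move=> ci; rewrite normrM [X in _ * X]ger0_norm ?exprn_ge0 ?(ltW th0) //.
  apply: le_trans (ler_wpM2r (exprn_ge0 _ (ltW th0)) ci) _.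
  by rewrite thE mulrA -exprMn mulfV ?gt_eqF // expr1n mul1r.
have mA : (m - A = g)%N by rewrite /A subKn.
have Tle : `|T| <= rho ^+ g * tau.
  have Am : (A <= m)%N by rewrite /A leq_subr.
  rewrite -mA; apply: le_trans _ (sum_geometric_tail n (ltW rho0) rho1 Am).
  apply: le_trans (ler_norm_sum _ _ _) _.
  rewrite big_nat [leRHS]big_nat; apply: ler_sum => i /andP[im _].
  by apply: tgam; rewrite /c -intr_norm; apply: tail1.
have rtau : rho ^+ g * tau <= 1 / 2.
  rewrite -(ler_pM2l (ltr0n R 2)) mulrCA.
  have Bd1 : 1 <= B ^+ d by rewrite exprn_ege1.
  have h : 2 * tau <= gam ^+ g.
    apply: le_trans (ltW gbig); rewrite -[leLHS]mulr1 ler_wpM2l //.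
    by rewrite mulr_ge0 // ltW.
  rewrite /rho exprVn ler_pdivrMl ?exprn_gt0 //.
  by rewrite mul1r divff ?mulr1 ?pnatr_eq0.
(* The term at [m] contributes at least [th ^+ g], the next [g] terms are nonnegative, and the
   remaining ones cost at most half of it. *)
have Tge : th ^+ g / 2 <= T.
  rewrite /T big_ltn; last by move: mgn; clear; lia.
  have -> : c m * th ^+ (m - A) + \sum_(m.+1 <= i < n) c i * th ^+ (i - A) =
     th ^+ g * (c m + \sum_(m.+1 <= i < n) c i * th ^+ (i - m)).
    rewrite mulrDr mulrC mA mulr_sumr; congr (_ + _).
    apply: eq_big_nat => i /andP[im _]; rewrite mulrCA -exprD; congr (_ * _ ^+ _).
    by move: im gm; rewrite /A; clear; lia.
  rewrite ler_pM2l ?exprn_gt0 //.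
  have c1 : 1 <= c m by rewrite /c ler1z -gtz0_ge1.
  rewrite (@big_cat_nat _ _ _ (m + g).+1) //=; last by clear; lia.
  set S1 := \sum_(m.+1 <= i < _) _; set S2 := \sum_(_.+1 <= i < n) _.
  have S10 : 0 <= S1.
    rewrite /S1 big_nat; apply: sumr_ge0 => i /andP[i1 i2].
    by rewrite mulr_ge0 ?exprn_ge0 ?(ltW th0) // /c ler0z Gpos // i1 -ltnS.
  have S2le : `|S2| <= rho ^+ g * tau.
    apply: (@le_trans _ _ (\sum_((m + g) <= i < n) rho ^+ (i - m))); last first.
      by rewrite -{2}(addKn m g); apply: sum_geometric_tail (ltW rho0) rho1 (leq_addr _ _).
    apply: le_trans (ler_norm_sum _ _ _) _.
    rewrite [leRHS]big_ltn // -[leLHS]add0r; apply: lerD; first by rewrite exprn_ge0 // ltW.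
    rewrite [leLHS]big_nat [leRHS]big_nat; apply: ler_sum => i /andP[im _].
    by apply: tgam; rewrite /c -intr_norm; apply: tail2; exact: ltnW.
  have := ler_norm (- S2); rewrite normrN => S2n.
  by lra.
have small' : beta ^+ A * `|(map_poly intr G).[th]| <= th ^+ g / 4.
  apply: le_trans (ler_wpM2l (exprn_ge0 _ (ltW b0)) small) _.
  rewrite mulrA ler_pM2r ?invr_gt0 //.
  have -> : m = (A + g)%N by rewrite /A subnK.
  by rewrite exprD invfM mulrA divff ?mul1r ?exprVn // expf_eq0 gt_eqF ?andbF.
have thg0 : 0 < th ^+ g by rewrite exprn_gt0.
have sm2 : `|f0 + T| <= th ^+ g / 4.
  by rewrite -GE normrM ger0_norm // exprn_ge0 // ltW.
have f0T : `|f0| <= 2 * (rho ^+ g * tau).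
  have := ler_normB (f0 + T) T; rewrite addrK.
  have := ler_norm T; lra.
(* If [f0] vanished, [Tge] would contradict [sm2]. *)
have f00 : f0 != 0.
  apply/eqP => f0z; move: sm2; rewrite f0z add0r.
  have := ler_norm T; lra.
have fb0 : (map_poly intr f).[beta] != 0.
  by apply: contraNneq f00 => h; rewrite /f0 h mulr0.
have := liou f fb0; apply/negP; rewrite -ltNge.
have fle : `|(map_poly intr f).[beta]| <= 2 * (rho ^+ g * tau).
  apply: le_trans f0T; rewrite /f0 normrM ler_peMl // ger0_norm ?ltW //.
have fB : (\sum_(i < size f) `|f`_i|)%:~R <= B.
  apply: le_trans GB; rewrite ler_int.
  apply: (@le_trans _ _ (\sum_(i < A) `|f`_i|)).
    rewrite (big_ord_widen A (fun i => `|f`_i|)) ?size_poly //.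
    by rewrite big_mkcond; apply: ler_sum => i _; case: ifP.
  rewrite (reindex_inj rev_ord_inj) /=; apply: ler_sum => i _.
  have := ltn_ord i => iA; rewrite coef_poly ifT; last by move: iA; clear; lia.
  by rewrite (_ : (A.-1 - (A - i.+1))%N = i) //; move: iA; clear; lia.
apply: (@le_lt_trans _ _ (2 * (rho ^+ g * tau) * B ^+ d)).
  apply: ler_pM => //; rewrite ?exprn_ge0 ?ler0z ?sumr_ge0 //.
  by apply: lerXn2r => //; rewrite nnegrE ?ler0z ?sumr_ge0 // (le_trans ler01).
have -> : 2 * (rho ^+ g * tau) * B ^+ d = rho ^+ g * (2 * tau * B ^+ d) by ring.
by rewrite /rho exprVn mulrC ltr_pdivrMr ?exprn_gt0 // mul1r.
Qed.

(** * A relation at one scale *)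

Lemma mass_monomial X (F1 F2 F3 : {poly nat}) k (B D : nat) :
  (mass X F1 <= B)%N -> (mass X F2 <= B)%N -> (mass X F3 <= B)%N -> (0 < B)%N ->
  (k.1.1 + k.1.2 <= D)%N -> (k.2 <= D)%N ->
  (mass X (monomial F1 F2 F3 k) <= B ^ (2 * D))%N.
Proof.
move=> h1 h2 h3 B0 kD1 kD2; rewrite mul2n -addnn expnD.
have le_exp i m : (m <= B)%N -> (m ^ i <= B ^ i)%N.
  by move=> mB; case: i => // i; rewrite leq_exp2r.
apply: leq_trans (mass_mul _ _ _) _; apply: leq_mul; last first.
  apply: leq_trans (mass_exp _ _ _) _; apply: (@leq_trans (B ^ k.2)).
    exact: le_exp.
  exact: leq_pexp2l.
apply: leq_trans (mass_mul _ _ _) _; apply: (@leq_trans (B ^ (k.1.1 + k.1.2))).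
  rewrite expnD; apply: leq_mul; apply: leq_trans (mass_exp _ _ _) _; exact: le_exp.
exact: leq_pexp2l.
Qed.

(** For truncated series, its value at theta is the relation evaluated at the truncations, and its
    coefficients play the role of the integers G_m. *)
Definition int_combination (ks : seq (nat * nat * nat)) (A : nat * nat * nat -> int)
    (F1 F2 F3 : {poly nat}) : {poly int} :=
  \sum_(k <- ks) A k *: map_poly Posz (monomial F1 F2 F3 k).

Lemma coef_int_combination ks A F1 F2 F3 m :
  (int_combination ks A F1 F2 F3)`_m =
  \sum_(k <- ks) A k * (natcoef (monomial F1 F2 F3 k) m)%:Z.
Proof.
by rewrite /int_combination coef_sum; apply: eq_bigr => k _; rewrite coefZ coef_map.
Qed.

Lemma mass_int_combination ks A F1 F2 F3 X (KK B D : nat) :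
  (mass X F1 <= B)%N -> (mass X F2 <= B)%N -> (mass X F3 <= B)%N -> (0 < B)%N ->
  (forall k, k \in ks -> (k.1.1 + k.1.2 <= D)%N /\ (k.2 <= D)%N) ->
  \sum_(k <- ks) `|A k| < KK%:Z ->
  \sum_(m < X) `|(int_combination ks A F1 F2 F3)`_m| <= (KK * B ^ (2 * D))%N%:Z.
Proof.
move=> h1 h2 h3 B0 hD hKK.
apply: (@le_trans _ _ (\sum_(m < X) \sum_(k <- ks) `|A k| * (natcoef (monomial F1 F2 F3 k) m)%:Z)).
  apply: ler_sum => m _; rewrite coef_int_combination.
  apply: le_trans (ler_norm_sum _ _ _) _; apply: ler_sum => k _.
  by rewrite normrM.
rewrite exchange_big /= PoszM.
apply: (@le_trans _ _ (\sum_(k <- ks) `|A k| * (B ^ (2 * D))%N%:Z)); last first.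
  by rewrite -mulr_suml; apply: ler_wpM2r => //; exact: ltW.
rewrite big_seq [leRHS]big_seq; apply: ler_sum => k kks.
rewrite -mulr_sumr; apply: ler_wpM2l => //.
have [kD1 kD2] := hD k kks.
rewrite -(big_morph Posz PoszD (erefl : Posz 0 = 0)) lez_nat.
exact: mass_monomial.
Qed.

Lemma horner_int_combination (R : realType) ks A F1 F2 F3 (x : R) :
  let ev (F : {poly nat}) := (map_poly (GRing.natmul 1 : nat -> R) F).[x] in
  (map_poly intr (int_combination ks A F1 F2 F3)).[x] =
  \sum_(k <- ks) (A k)%:~R * (ev F1 ^+ k.1.1 * ev F2 ^+ k.1.2 * ev F3 ^+ k.2).
Proof.
move=> ev; rewrite /int_combination rmorph_sum /= horner_sum; apply: eq_bigr => k _.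
rewrite map_polyZ /= hornerZ -map_poly_comp /=; congr (_ * _).
by rewrite /monomial !rmorphM !rmorphXn /= !hornerM !horner_exp.
Qed.

Lemma horner_expsum (R : realType) a b (c w : nat -> nat) (x : R) :
  (map_poly (GRing.natmul 1 : nat -> R) (expsum a b c w)).[x] =
  \sum_(a <= n < b) (c n)%:R * x ^+ w n.
Proof.
rewrite /expsum rmorph_sum /= horner_sum; apply: eq_bigr => n _.
by rewrite rmorphMn /= map_polyXn hornerMn hornerXn mulr_natl.
Qed.

Lemma sub_supp_expsum (a b : nat) (c c' w : nat -> nat) :
  (forall n, (a <= n < b)%N -> (0 < c' n)%N) -> sub_supp (expsum a b c w) (expsum a b c' w).
Proof.
move=> c0 m /expsum_gt0P[n [ab _ wn]]; apply/expsum_gt0P; exists n; split => //.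
exact: c0.
Qed.

Lemma mass_expsum_size X a b w : (mass X (expsum a b (fun=> 1%N) w) <= b - a)%N.
Proof.
rewrite /mass; under eq_bigr do rewrite coef_expsum.
rewrite exchange_big /=; apply: (@leq_trans (\sum_(a <= n < b) 1)); last first.
  by rewrite sum_nat_const_nat muln1.
apply: leq_sum => n _; rewrite -big_distrr /= mul1n.
have [wX|Xw] := ltnP (w n) X.
  by rewrite (bigD1 (Ordinal wX)) //= eqxx big1 // => i; rewrite -val_eqE /= => /negbTE ->.
by rewrite big1 // => i _; rewrite ltn_eqF // (leq_trans (ltn_ord i)).
Qed.

(** [isolated_positive] finds a positive coefficient after a gap and [gap_contradiction] excludes
    it. All sizes are parameters: [Om] bounds the exponents searched, only indices below [kap] and
    [lam] can give values of [w] and [v] below [Om], [n0] separates small indices from large ones,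
    and [B y] bounds the sum of the absolute coefficients at exponents reached only by indices below
    [y]. *)
Lemma no_relation_at_scale (R : realType) (gam : R) (d : nat) (w v u1 u2 u3 : nat -> nat)
    (m0 m3 n0 N C0 : nat) (ks : seq (nat * nat * nat)) (A : nat * nat * nat -> int)
    (top : nat * nat * nat) (e c D KK K r q g L l kap lam : nat) :
  let beta := gam ^+ 2 in
  let Om := w (2 * K ^ (r + e.+1))%N in
  let B y := (KK * (C0 * 2 ^ y) ^ (2 * D))%N in
  1 < gam ->
  (forall f : {poly int}, (map_poly intr f).[beta] != 0 ->
     1 <= `|(map_poly intr f).[beta]| * (\sum_(i < size f) `|f`_i|)%:~R ^+ d) ->
  (m0 <= n0 <= N)%N ->
  (forall n, (n0 <= n)%N -> (KK * u2 n <= u1 n)%N) ->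
  (forall n, (m0 <= n)%N -> (0 < u2 n)%N) -> (forall n, (m3 <= n)%N -> (0 < u3 n)%N) ->
  (forall n, [/\ u1 n <= C0 * 2 ^ n, u2 n <= C0 * 2 ^ n & u3 n <= C0 * 2 ^ n]%N) ->
  uniq ks -> top \in ks ->
  (top.1.1 + top.1.2 = e.+1)%N -> top.2 = c.+1 ->
  (forall k, k \in ks -> (k.1.1 + k.1.2 <= e.+1)%N /\ (k.2 <= D)%N) ->
  (forall k, k \in ks -> (k.1.1 + k.1.2 = e.+1)%N -> (k.2 <= c.+1)%N) ->
  (forall k, k \in ks -> (k.1.1 + k.1.2 = e.+1)%N -> k.2 = c.+1 ->
     (k.1.1 <= top.1.1)%N) ->
  0 < A top -> \sum_(k <- ks) `|A k| < KK%:Z ->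
  (e < D)%N -> (c <= D)%N ->
  (0 < K)%N ->
  (forall j n, (r <= j < r + e.+1)%N -> (K ^ j.+1 <= n < 2 * K ^ j.+1)%N ->
     (w n + w (2 * K ^ j) <= w n.+1)%N /\ (n0 <= n < N)%N) ->
  (forall n, (kap <= n)%N -> (Om <= w n)%N) ->
  (forall n, (lam <= n)%N -> (Om <= v n)%N) ->
  ((1 + n0) * (1 + kap) ^ e * (1 + lam) ^ D < (K ^ r.+1) ^ e.+1)%N ->
  (((1 + kap) * (1 + lam)) ^ D < q)%N ->
  (q * L < w (2 * K ^ r))%N -> (0 < g)%N -> (m3 <= l < N)%N ->
  (q * g <= v l)%N -> (v l + g <= L)%N ->
  (forall R0 i, (R0 < Om)%N -> (R0 + g <= i)%N ->
     exists2 y, (forall n, (y <= n)%N -> (i < w n)%N /\ (i < v n)%N) &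
       (B y)%:R <= gam ^+ (i - R0)) ->
  (exists2 y, (forall n, (y <= n)%N -> (Om <= w n)%N /\ (Om <= v n)%N) &
       2 * (1 - gam^-1)^-1 * (B y)%:R ^+ d < gam ^+ g) ->
  `|\sum_(k <- ks) (A k)%:~R * ((\sum_(m0 <= n < N) (u1 n)%:R * beta^-1 ^+ w n) ^+ k.1.1
     * (\sum_(m0 <= n < N) (u2 n)%:R * beta^-1 ^+ w n) ^+ k.1.2
     * (\sum_(m3 <= n < N) (u3 n)%:R * beta^-1 ^+ v n) ^+ k.2)| <= beta ^- Om / 4 ->
  False.
Proof.
move=> beta Om B gam1 liou m0n0N ratio u2p u3p uC uks tks tope topc kse ksc ksa At AKK
  eD cD K0 hbox hkap hlam hBd hq hL g0 lN qgl lL tails [yO yOw gbig] small.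
pose one (_ : nat) := 1%N.
have [m0n0 n0N] := andP m0n0N.
pose s1 := expsum m0 n0 u1 w; pose h1 := expsum n0 N u1 w.
pose s2 := expsum m0 n0 u2 w; pose h2 := expsum n0 N u2 w.
pose F3 := expsum m3 N u3 v.
pose Hs := expsum m0 n0 one w; pose H := expsum n0 N one w; pose V := expsum m3 N one v.
have F1E : expsum m0 N u1 w = s1 + h1 by apply: expsum_cat.
have F2E : expsum m0 N u2 w = s2 + h2 by apply: expsum_cat.
pose GG := int_combination ks A (s1 + h1) (s2 + h2) F3.
have KK0 : (0 < KK)%N by rewrite -ltz_nat (le_lt_trans _ AKK) // sumr_ge0.
have C00 : (0 < C0)%N.
  have [_ + _] := uC n0; have := u2p n0 m0n0.
  by case: (C0) => // u20; rewrite mul0n leqNgt u20.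
have kD k : k \in ks -> (k.1.1 + k.1.2 <= D)%N /\ (k.2 <= D)%N.
  by move=> /kse[h ?]; split => //; apply: leq_trans eD.
have sum2 y : (\sum_(n < y) C0 * 2 ^ n <= C0 * 2 ^ y)%N.
  rewrite -big_distrr leq_mul2l /=; apply/orP; right.
  elim: y => [|y IH]; first by rewrite big_ord0.
  by rewrite big_ord_recr expnS mul2n -addnn leq_add2r.
(* Below [X] only indices below [y] contribute, and in each series their coefficients add up to at
   most [C0 * 2 ^ y]. *)
have GGB X y : (forall n, (y <= n)%N -> (X <= w n)%N /\ (X <= v n)%N) ->
    \sum_(m < X) `|GG`_m| <= (B y)%:Z.
  move=> hy; apply: mass_int_combination AKK => //.
  - rewrite -F1E; apply: (leq_trans (mass_expsum (y := y) _ _ _)).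
      by move=> n _ /hy[].
    by apply: leq_trans (sum2 y); apply: leq_sum => i _; have [] := uC i.
  - rewrite -F2E; apply: (leq_trans (mass_expsum (y := y) _ _ _)).
      by move=> n _ /hy[].
    by apply: leq_trans (sum2 y); apply: leq_sum => i _; have [] := uC i.
  - apply: (leq_trans (mass_expsum (y := y) _ _ _)).
      by move=> n _ /hy[].
    by apply: leq_trans (sum2 y); apply: leq_sum => i _; have [] := uC i.
  - by rewrite muln_gt0 C00 expn_gt0.
have tail R0 i : (R0 < Om)%N -> (R0 + g <= i)%N -> `|GG`_i|%:~R <= gam ^+ (i - R0).
  move=> RO Ri; have [y hy By] := tails R0 i RO Ri.
  apply: le_trans By; rewrite pmulrn ler_int.
  apply: le_trans (GGB i.+1 y hy).
  by rewrite big_ord_recr lerDr sumr_ge0.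
have sgn m : natcoef ((1 + Hs) * (1 + (Hs + H)) ^+ e * (1 + V) ^+ D) m = 0%N ->
    natcoef (H ^+ e.+1 * (1 + V) ^+ c) m = 0%N ->
    0 <= GG`_m /\ ((0 < natcoef (H ^+ e.+1 * V ^+ c.+1) m)%N -> 0 < GG`_m).
  rewrite coef_int_combination; apply: (@coef_sign ks A top _ _ _ _ _ _ _ _ e c D KK) => //.
  - exact: sub_supp_expsum.
  - exact: sub_supp_expsum.
  - exact: sub_supp_expsum.
  - exact: sub_supp_expsum.
  - by apply: sub_supp_expsum => n /andP[n0n _]; rewrite u2p // (leq_trans m0n0).
  - exact: sub_supp_expsum.
  - by apply: sub_supp_expsum => n /andP[m3n _]; rewrite u3p.
  - move=> i; rewrite coefMn_nat !coef_expsum big_distrl /= big_nat [leqRHS]big_nat.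
    apply: leq_sum => n /andP[n0n _].
    by rewrite mulnAC [(_ * KK)%N]mulnC leq_mul2r ratio // orbT.
have HHs : Hs + H = expsum m0 N one w by apply/esym/expsum_cat.
have sum1 y : (\sum_(n < y) one n)%N = y by rewrite sum1_card card_ord.
have mHs : (mass Om Hs <= n0)%N.
  by apply: leq_trans (mass_expsum_size _ _ _ _) (leq_subr _ _).
have mW : (mass Om (1 + (Hs + H)) <= 1 + kap)%N.
  rewrite mass_add leq_add ?mass1 // HHs -[leqRHS]sum1; apply: mass_expsum => n _; exact: hkap.
have mV : (mass Om (1 + V) <= 1 + lam)%N.
  by rewrite mass_add leq_add ?mass1 // -[leqRHS]sum1; apply: mass_expsum => n _; exact: hlam.
have le_exp i a b : (a <= b)%N -> (a ^ i <= b ^ i)%N.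
  by move=> ab; case: i => // i; rewrite leq_exp2r.
have mVX j : (j <= D)%N -> (mass Om ((1 + V) ^+ j) <= (1 + lam) ^ D)%N.
  move=> jD; apply: leq_trans (mass_exp _ _ _) _; apply: (@leq_trans ((1 + lam) ^ j)).
    exact: le_exp.
  exact: leq_pexp2l.
have mWX j : (mass Om ((1 + (Hs + H)) ^+ j) <= (1 + kap) ^ j)%N.
  by apply: leq_trans (mass_exp _ _ _) _; apply: le_exp.
have [m [gm mO Gm Gz Gp]] : exists m, [/\ (g <= m)%N, (m + g < Om)%N, 0 < GG`_m,
     forall i, (m - g <= i < m)%N -> GG`_i = 0 &
     forall i, (m < i <= m + g)%N -> 0 <= GG`_i].
  apply: (@isolated_positive (fun m => GG`_m) H V
     ((1 + Hs) * (1 + (Hs + H)) ^+ e * (1 + V) ^+ D) w (fun j => w (2 * K ^ j)%N)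
     K r e.+1 c q L g (v l)) => //.
  - move=> j n hj hn; have [h1' h2'] := hbox j n hj hn; split => //.
    by apply/expsum_gt0P; exists n.
  - apply: leq_ltn_trans hBd; apply: leq_trans (mass_mul _ _ _) _.
    rewrite leq_mul ?mVX //; apply: leq_trans (mass_mul _ _ _) _.
    by rewrite leq_mul // mass_add leq_add // mass1.
  - apply: leq_ltn_trans hq; apply: leq_trans (mass_mul _ _ _) _.
    rewrite expnMn leq_mul ?mVX //.
    apply: (@leq_trans (mass Om ((1 + (Hs + H)) ^+ e.+1))).
      by apply: le_mass; apply: le_coefX => i; rewrite !coefD_nat addnA leq_addl.
    by apply: leq_trans (mWX _) _; rewrite leq_pexp2l.
  (* Every monomial is supported on sums of at most [D] values of [w] and at most [D] values of [v],
     which bounds the number of nonzero coefficients. *)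
  - apply: leq_ltn_trans hq.
    apply: (@leq_trans (mass Om ((1 + (Hs + H)) ^+ D * (1 + V) ^+ D))); last first.
      by apply: leq_trans (mass_mul _ _ _) _; rewrite expnMn leq_mul ?mVX.
    apply: leq_trans _ (count_in_mass _ _).
    rewrite /count_in; apply: leq_sum => i _; case: eqP => //=.
    rewrite coef_int_combination => /eqP Gi0; rewrite lt0b.
    have [k kks ki] : exists2 k, k \in ks & (0 < natcoef (monomial (s1 + h1) (s2 + h2) F3 k) i)%N.
      apply: contrapT => no; case/negP: Gi0; rewrite big_seq big1 // => k kks.
      have -> : natcoef (monomial (s1 + h1) (s2 + h2) F3 k) i = 0%N.
        by apply/eqP; rewrite -leqn0 leqNgt; apply/negP => ?; apply: no; exists k.
      by rewrite mulr0.
    have [k1 k2] := kD k kks.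
    suff : sub_supp (monomial (s1 + h1) (s2 + h2) F3 k) ((1 + (Hs + H)) ^+ D * (1 + V) ^+ D).
      by apply.
    apply: sub_suppM; last first.
      apply: sub_supp_trans _ (sub_supp_add1X k2); apply: sub_suppX.
      by apply: sub_suppDr; exact: sub_supp_expsum.
    apply: sub_supp_trans _ (sub_supp_add1X k1); rewrite exprD.
    apply: sub_suppM; apply: sub_suppX; apply: sub_suppDr; rewrite HHs.
      by rewrite -F1E; exact: sub_supp_expsum.
    by rewrite -F2E; exact: sub_supp_expsum.
  - by apply/expsum_gt0P; exists l.
have HS := @gap_contradiction R gam GG d g m (B yO)%:R gam1 liou gm Gm Gz Gp.
apply: HS.
- by move=> i mi; apply: tail; move: mi gm mO; clear; lia.
- by move=> i mi; apply: tail; move: mi gm mO; clear; lia.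
- rewrite pmulrn ler_int; apply: le_trans (GGB Om yO yOw).
  rewrite (big_ord_widen Om (fun i => `|GG`_i|)); last by move: mO; clear; lia.
  by rewrite big_mkcond; apply: ler_sum => i _; case: ifP.
- by rewrite ler1n /B muln_gt0 KK0 expn_gt0 muln_gt0 C00 expn_gt0.
- exact: gbig.
(* As [m < Om], the error bound [beta ^- Om / 4] is at most [beta ^- m / 4]. *)
- rewrite horner_int_combination -F1E -F2E !horner_expsum.
  apply: le_trans small _; rewrite ler_pM2r ?invr_gt0 //.
  have gam0 : 0 < gam by exact: lt_trans gam1.
  have b1 : 1 < gam ^+ 2 by rewrite expr_gt1 // ltW.
  rewrite lef_pV2 ?posrE ?exprn_gt0 ?(lt_trans ltr01 b1) //.
  by rewrite ler_eXn2l //; move: mO; clear; lia.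
Qed.

(** * Growth conditions and the choice of the scale *)

Definition superpolynomial (w : nat -> nat) : Prop :=
  forall k, \forall n \near \oo, (n ^ k <= w n)%N.

(* [n'] ranges over the indices with [n' <= n ^ (s / s.+1)]. *)
Definition dominating_gaps (w : nat -> nat) : Prop :=
  forall s, \forall n \near \oo, forall n',
    (n' ^ s.+1 <= n ^ s)%N -> (w n + 2 * w n' <= w n.+1)%N.

(** For [k = 1] this gives [w <= v] eventually; for larger [k] it makes the values of [v] below a
    bound far fewer than those of [w]. *)
Definition much_sparser (w v : nat -> nat) : Prop :=
  forall k, \forall n \near \oo, (w (n ^ k) <= v n)%N.

(** When [v] is unbounded, this provides a value of [v] between a large bound and a fixed power of
    it. *)
Definition poly_step (v : nat -> nat) : Prop :=
  exists b, \forall n \near \oo, (v n.+1 <= v n ^ b)%N.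

Definition poly_bounded (f : nat -> nat) : Prop :=
  exists k, \forall J \near \oo, (f J <= J ^ k)%N.

Lemma near_threshold (P : nat -> Prop) :
  (\forall n \near \oo, P n) -> exists n0, forall n, (n0 <= n)%N -> P n.
Proof. by move=> [n0 _ h]; exists n0. Qed.

Lemma leq_exp2 k m n : (m <= n)%N -> (m ^ k <= n ^ k)%N.
Proof. by move=> mn; case: k => // k; rewrite leq_exp2r. Qed.

Lemma poly_bounded_cst c : poly_bounded (fun=> c).
Proof.
by exists 1%N; near=> J; rewrite expn1; near: J; exact: nbhs_infty_ge.
Unshelve. all: by end_near.
Qed.

Lemma poly_bounded_id : poly_bounded id.
Proof.
by exists 1%N; near=> J; rewrite expn1.
Unshelve. all: by end_near.
Qed.

Lemma poly_boundedM f g :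
  poly_bounded f -> poly_bounded g -> poly_bounded (fun J => f J * g J)%N.
Proof.
move=> [i hf] [j hg]; exists (i + j)%N; near=> J; rewrite expnD leq_mul //; near: J; assumption.
Unshelve. all: by end_near.
Qed.

Lemma poly_boundedD f g :
  poly_bounded f -> poly_bounded g -> poly_bounded (fun J => f J + g J)%N.
Proof.
move=> [i hf] [j hg]; exists (i + j).+1; near=> J.
have J2 : (2 <= J)%N by near: J; exact: nbhs_infty_ge.
have J0 : (0 < J)%N by apply: leq_trans J2.
rewrite expnS; apply: (@leq_trans (2 * J ^ (i + j))); last by rewrite leq_mul2r J2 orbT.
rewrite mul2n -addnn; apply: leq_add.
  apply: (@leq_trans (J ^ i)); first by near: J; assumption.
  by rewrite leq_pexp2l // leq_addr.
apply: (@leq_trans (J ^ j)); first by near: J; assumption.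
by rewrite leq_pexp2l // leq_addl.
Unshelve. all: by end_near.
Qed.

Lemma poly_boundedX f n : poly_bounded f -> poly_bounded (fun J => f J ^ n)%N.
Proof.
move=> [i hf]; exists (i * n)%N; near=> J; rewrite expnM; apply: leq_exp2.
by near: J; assumption.
Unshelve. all: by end_near.
Qed.

(** Take [y] about [j / T.+1]: then [T * y.+1 <= j], whereas [w n >= n ^ 2] exceeds [2 * j] for
    large [j]. This serves to absorb the growth of the coefficients at remote exponents. *)
Lemma far_tail (w v : nat -> nat) (T : nat) :
  superpolynomial w -> much_sparser w v ->
  exists j0, forall j, (j0 <= j)%N -> exists2 y, (T * y.+1 <= j)%N &
    forall n, (y <= n)%N -> (2 * j < w n)%N /\ (2 * j < v n)%N.
Proof.
move=> /(_ 2) /near_threshold[n1 hw] /(_ 1%N) /near_threshold[n2 hv].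
pose S := T.+1; exists (S * (n1 + n2 + 4 * S + 6))%N => j hj.
pose x := (j %/ S)%N.
have S0 : (0 < S)%N by [].
have jx : (S * x <= j)%N by rewrite mulnC leq_trunc_div.
have xj : (j < S * x.+1)%N by rewrite mulnC ltn_ceil.
have xbig : (n1 + n2 + 4 * S + 6 <= x)%N by rewrite leq_divRL // mulnC.
exists x.-1.
  rewrite prednK; last by lia.
  by apply: leq_trans jx; rewrite leq_mul2r leqnSn orbT.
move=> n xn.
have jn : (2 * j < n ^ 2)%N.
  have h1 : (2 * j < 2 * S * x.+1)%N by rewrite -mulnA ltn_mul2l.
  apply: (leq_trans h1); apply: leq_trans (leq_exp2 2 xn).
  have z4 : (2 * S * 2 <= x.-1)%N by lia.
  apply: (@leq_trans (2 * S * 2 * x.-1)); last by rewrite -mulnn leq_mul2r z4 orbT.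
  by rewrite -!mulnA !leq_mul2l /=; lia.
have wn : (2 * j < w n)%N by apply: leq_trans jn (hw n _); lia.
split => //; apply: leq_trans wn _; have := hv n; rewrite expn1; apply; lia.
Qed.

(* All counts are bounded by a power of the scale [J], with [K = J ^ D.+2], whereas
   the lengths of the intervals are values of [w], hence superpolynomial in [J]. *)
Lemma choose_scale (w v : nat -> nat) (m3 n0 e D t C1 d c2 j0 : nat) :
  (0 < t)%N -> (0 < c2)%N -> (e < D)%N ->
  superpolynomial w -> dominating_gaps w -> much_sparser w v -> poly_step v ->
  exists K r l lam q L,
    let Om := w (2 * K ^ (r + e.+1))%N in
    let kap := (2 * K ^ (r + e.+1))%N in
    let y := (2 * K ^ (r + e.+1).+1)%N in
    let g := (t * (d.+1 * (C1 * y.+1) + c2))%N in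
    [/\ [/\ (0 < K)%N, (n0 <= y)%N, (j0 <= Om)%N &
         forall j n, (r <= j < r + e.+1)%N -> (K ^ j.+1 <= n < 2 * K ^ j.+1)%N ->
           (w n + w (2 * K ^ j) <= w n.+1)%N /\ (n0 <= n < y)%N],
     [/\ forall n, (y <= n)%N -> (2 * Om <= w n)%N /\ (2 * Om <= v n)%N,
         forall n, (kap <= n)%N -> (Om <= w n)%N &
         forall n, (lam <= n)%N -> (Om <= v n)%N],
     ((1 + n0) * (1 + kap) ^ e * (1 + lam) ^ D < (K ^ r.+1) ^ e.+1)%N,
     (((1 + kap) * (1 + lam)) ^ D < q)%N &
     [/\ (q * L < w (2 * K ^ r))%N, (m3 <= l)%N, (q * g <= v l)%N & (v l + g <= L)%N]].
Proof.
move=> t0 c20 eD sw gw sv [b tv].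
(* [r > e * e] gives [s * e + 1 < r.+1 * e.+1], so the sums of values of [w] outnumber the
   exceptions. Of the [D.+2] factors [J] in [K J], one pays for the constant [3 ^ (e + D)] and the
   others for [J * J ^ D]. *)
pose r := (e * e).+1; pose s := (r + e.+1)%N; pose a := D.+2.
have [nS hS] := near_threshold (gw s.+1).
have [nT hT] := near_threshold (sv (a * s)%N).
have [nU hU] := near_threshold (sv 1%N).
have [nB hB] := near_threshold tv.
have [n1 h1] := near_threshold (sw 1%N).
pose l0 := (nB + m3)%N.
pose K J := (J ^ a)%N; pose kap J := (2 * K J ^ s)%N; pose lam J := (2 * J)%N.
pose y J := (2 * K J ^ s.+1)%N.
pose g J := (t * (d.+1 * (C1 * (y J).+1) + c2))%N.
pose q J := (((1 + kap J) * (1 + lam J)) ^ D + 1)%N.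
pose L J := ((q J * g J) ^ b + g J)%N.
have pbK : poly_bounded K by apply: poly_boundedX; exact: poly_bounded_id.
have pc c := poly_bounded_cst c.
have pbkap : poly_bounded kap by apply: poly_boundedM => //; exact: poly_boundedX.
have pblam : poly_bounded lam by apply: poly_boundedM => //; exact: poly_bounded_id.
have pby : poly_bounded y by apply: poly_boundedM => //; exact: poly_boundedX.
have pbg : poly_bounded g.
  apply: poly_boundedM => //; apply: poly_boundedD => //; apply: poly_boundedM => //.
  apply: poly_boundedM => //; rewrite (_ : (fun J => _) = (fun J => 1 + y J)%N) //.
  exact: poly_boundedD.
have pbq : poly_bounded q.
  apply: poly_boundedD => //; apply: poly_boundedX.
  by apply: poly_boundedM; exact: poly_boundedD.
have pbL : poly_bounded L.
  by apply: poly_boundedD => //; apply: poly_boundedX; exact: poly_boundedM.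
have [kk hkk] : poly_bounded (fun J => q J * L J + 1)%N.
  by apply: poly_boundedD => //; exact: poly_boundedM.
have [nk hk] := near_threshold (sw kk).
have [J0 HJ0] := near_threshold hkk.
(* The sum exceeds all thresholds and constants at once. *)
pose J := (J0 + nS + nT + nU + n1 + nk + n0 + j0 + v l0 + 3 ^ (e + D) + 2 ^ s.+2 + 1)%N.
have J1 : (0 < J)%N by rewrite /J; lia.
have JK : (J <= K J)%N by rewrite /K expnS leq_pmulr // expn_gt0 J1.
have K0 : (0 < K J)%N by apply: leq_trans JK.
have Kexp j : (K J <= K J ^ j.+1)%N by rewrite expnS leq_pmulr // expn_gt0 K0.
have J2K j : (J <= 2 * K J ^ j.+1)%N.
  by apply: leq_trans JK (leq_trans (Kexp j) _); rewrite leq_pmull.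
(* Monotonicity is [dominating_gaps] at [n' = 0]. *)
have mono_w m n : (nS <= m)%N -> (m <= n)%N -> (w m <= w n)%N.
  move=> Sm /subnK <-; elim: (n - m)%N => [//|i IH].
  apply: leq_trans IH _; rewrite addSn.
  apply: leq_trans (hS _ _ 0%N _); first by rewrite leq_addr.
    by apply: leq_trans Sm (leq_addl _ _).
  by rewrite exp0n.
have JnS : (nS <= J)%N by rewrite /J; lia.
(* Writing K for [K J]: for [j <= s], [(2 * K ^ j) ^ s.+2 <= K ^ (j * s.+2).+1 <= (K ^ j.+1) ^
   s.+1], which is the premise of [dominating_gaps] at [s.+1]. *)
have step j n : (j <= s)%N -> (K J ^ j.+1 <= n)%N ->
    (w n + 2 * w (2 * K J ^ j) <= w n.+1)%N.
  move=> js Kn; apply: hS.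
    by apply: leq_trans JnS _; apply: leq_trans JK _; apply: leq_trans (Kexp _) Kn.
  apply: (@leq_trans ((K J ^ j.+1) ^ s.+1)); last exact: leq_exp2.
  rewrite expnMn -!(expnM (K J)).
  apply: (@leq_trans (K J * K J ^ (j * s.+2))).
    rewrite leq_mul2r; apply/orP; right; apply: leq_trans JK.
    by rewrite /J; lia.
  by rewrite -expnS leq_pexp2l //; move: js; clearbody s; clear; nia.
have Jkap : (J <= kap J)%N by rewrite /kap /s addnS.
have Omw n : (kap J <= n)%N -> (w (kap J) <= w n)%N.
  by apply: mono_w; apply: leq_trans JnS Jkap.
have wX : (2 * w (kap J) <= w (y J))%N.
  apply: (@leq_trans (w (K J ^ s.+1).+1)).
    by apply: leq_trans (step s _ (leqnn _) (leqnn _)); rewrite leq_addl.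
  apply: mono_w; first by apply: leq_trans JnS _; apply: leq_trans JK _; exact: leqW.
  by rewrite /y mul2n -addnn -addn1 leq_add2l expn_gt0 K0.
have yJ : (J <= y J)%N.
  exact: J2K.
have wXn n : (y J <= n)%N -> (2 * w (kap J) <= w n)%N.
  move=> yn; apply: leq_trans wX _; apply: mono_w => //; exact: leq_trans JnS yJ.
have vw n : (J <= n)%N -> (w n <= v n)%N.
  by move=> Jn; have := hU n; rewrite expn1; apply; move: Jn; rewrite /J; lia.
have g0 : (0 < g J)%N by rewrite /g muln_gt0 t0 addn_gt0 c20 orbT.
have D0 : (0 < D)%N by apply: leq_trans eD.
have Jq : (v l0 < q J * g J)%N.
  apply: (@leq_trans (q J)); last by rewrite leq_pmulr.
  rewrite /q addn1 ltnS; apply: (@leq_trans ((1 + lam J) ^ 1)).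
    by rewrite expn1 /lam /J; lia.
  apply: (@leq_trans ((1 + lam J) ^ D)); first by rewrite leq_pexp2l.
  by apply: leq_exp2; rewrite leq_pmull.
(* [l] is the least index from [l0] on with value at least [q J * g J]. The preceding value is
   smaller, so [poly_step] bounds [v l] by a power of that number; [Jq] rules out [l = l0]. *)
have [l hl lmin] : exists2 l, (l0 <= l)%N && (q J * g J <= v l)%N &
    forall i, (l0 <= i)%N && (q J * g J <= v i)%N -> (l <= i)%N.
  have ex : exists i, (l0 <= i)%N && (q J * g J <= v i)%N.
    exists (l0 + J + q J * g J)%N; rewrite -addnA leq_addr /=.
    apply: leq_trans _ (vw _ _); last by rewrite addnCA leq_addr.
    have := h1 (l0 + (J + q J * g J))%N; rewrite expn1 => h.
    apply: leq_trans _ (h _); first by rewrite addnA leq_addl.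
    by rewrite /J; lia.
  by case: (ex_minnP ex) => l hl lm; exists l.
have [l0l qgl] := andP hl.
have vl : (v l <= (q J * g J) ^ b)%N.
  have ll0 : (l0 < l)%N.
    by rewrite ltn_neqAle l0l andbT; apply: contraTneq qgl => <-; rewrite -ltnNge.
  have lE : l = l.-1.+1 by rewrite prednK // (leq_trans _ ll0).
  have l0l1 : (l0 <= l.-1)%N by rewrite -ltnS -lE.
  have vl1 : (v l.-1 < q J * g J)%N.
    rewrite ltnNge; apply/negP => h.
    by have := lmin l.-1; rewrite l0l1 h => /(_ isT); rewrite {1}lE ltnn.
  rewrite {1}lE; apply: leq_trans (hB _ _) _; last by apply: leq_exp2; exact: ltnW.
  by apply: leq_trans l0l1; rewrite leq_addr.
exists (K J), r, l, (lam J), (q J), (L J); split.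
- split => //.
  + by apply: leq_trans yJ; rewrite /J; lia.
  + apply: (@leq_trans J); first by rewrite /J; lia.
    apply: (leq_trans Jkap).
    have := h1 (kap J); rewrite expn1; apply.
    by apply: leq_trans Jkap; rewrite /J; lia.
  + move=> j n /andP[rj js] /andP[n2 n3]; split.
      apply: leq_trans (step j n _ n2); last exact: ltnW.
      by rewrite leq_add2l leq_pmull.
    apply/andP; split.
      apply: (@leq_trans J); first by rewrite /J; lia.
      by apply: leq_trans JK _; apply: leq_trans (Kexp _) n2.
    apply: leq_trans n3 _; rewrite leq_mul2l leq_pexp2l //=.
    by rewrite ltnS ltnW.
- split => //.
  + move=> n yn; split; first exact: wXn.
    apply: leq_trans (wXn n yn) (vw n _); exact: leq_trans yJ yn.
  (* [lam J = 2 * J] is large enough because [kap J <= (2 * J) ^ (a * s)]. *)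
  + move=> n ln; apply: leq_trans (hT n _); last by move: ln; rewrite /lam /J; lia.
    apply: Omw; rewrite /kap /K -expnM.
    apply: (@leq_trans ((2 * J) ^ (a * s))); last exact: leq_exp2.
    rewrite expnMn leq_mul2r; apply/orP; right.
    by rewrite -{1}(expn1 2) leq_pexp2l // /a /s addnS.
- have b1 : (1 + n0 <= J)%N by rewrite /J; lia.
  have b2 : ((1 + kap J) ^ e <= 3 ^ e * K J ^ (s * e))%N.
    rewrite expnM -expnMn; apply: leq_exp2; rewrite /kap.
    by have := Kexp (r + e)%N; rewrite -addnS -/s; lia.
  have b3 : ((1 + lam J) ^ D <= 3 ^ D * J ^ D)%N.
    by rewrite -expnMn; apply: leq_exp2; rewrite /lam; lia.
  apply: (@leq_ltn_trans (J * (3 ^ e * K J ^ (s * e)) * (3 ^ D * J ^ D))).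
    by rewrite !leq_mul.
  apply: (@leq_ltn_trans (K J ^ (s * e).+1)).
    have -> : (J * (3 ^ e * K J ^ (s * e)) * (3 ^ D * J ^ D) =
       (3 ^ (e + D) * (J * J ^ D)) * K J ^ (s * e))%N by rewrite expnD; lia.
    rewrite [X in (_ <= X)%N]expnS leq_mul2r; apply/orP; right.
    rewrite /K /a [X in (_ <= X)%N]expnS -expnS leq_mul2r; apply/orP; right.
    by rewrite /J; lia.
  rewrite -expnM ltn_exp2l; last first.
    apply: leq_trans JK; rewrite /J.
    by have := expn_gt0 2 s.+2; have := expn_gt0 3 (e + D); lia.
  by rewrite /s /r; nia.
- by rewrite /q addn1.
- split => //.
  + have := HJ0 J; rewrite addn1 => h; apply: leq_trans (h _) _.
      by rewrite /J; lia.
    apply: (@leq_trans ((2 * K J ^ r) ^ kk)).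
      by apply: leq_exp2; apply: J2K.
    by apply: hk; apply: leq_trans (J2K _); rewrite /J; lia.
  + by apply: leq_trans l0l; rewrite leq_addl.
  + by rewrite /L leq_add2r.
Qed.

(** * From finite scales to the limits *)

Lemma expr_unbounded (R : realType) (x M : R) : 1 < x -> exists n : nat, M < x ^+ n.
Proof.
move=> x1; have bern n : 1 + n%:R * (x - 1) <= x ^+ n.
  elim: n => [|n IH]; first by rewrite mul0r addr0 expr0.
  rewrite exprS; apply: (@le_trans _ _ (x * (1 + n%:R * (x - 1)))); last first.
    by rewrite ler_wpM2l // (le_trans ler01 (ltW x1)).
  have n0 : 0 <= n%:R :> R by [].
  rewrite -(natr1 n) -subr_ge0.
  rewrite (_ : _ - _ = n%:R * (x - 1) ^+ 2); last by ring.
  by rewrite mulr_ge0 ?sqr_ge0.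
have x10 : 0 < x - 1 by rewrite subr_gt0.
exists (Num.bound (M / (x - 1))); apply: lt_le_trans (bern _).
have [M0|M0] := leP 0 (M / (x - 1)); last first.
  have : M < 0 by move: M0; rewrite ltr_pdivrMr // mul0r.
  move=> Mn; apply: lt_le_trans Mn _; rewrite addr_ge0 // mulr_ge0 // ltW //.
have := archi_boundP M0; rewrite ltr_pdivrMr // => hM.
by rewrite (lt_le_trans hM) // lerDr.
Qed.

(** The constants are fixed first, then the scale, and the truncation point [N] last: a relation
    satisfied in the limit makes the truncated one at most [beta ^- Om / 4]. *)
Lemma no_relation_top (R : realType) (gam : R) (d : nat) (w v u1 u2 u3 : nat -> nat)
    (m0 m3 C0 : nat) (ks : seq (nat * nat * nat)) (A : nat * nat * nat -> int)
    (top : nat * nat * nat) (e c D : nat) :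
  let beta := gam ^+ 2 in
  1 < gam ->
  (forall f : {poly int}, (map_poly intr f).[beta] != 0 ->
     1 <= `|(map_poly intr f).[beta]| * (\sum_(i < size f) `|f`_i|)%:~R ^+ d) ->
  superpolynomial w -> dominating_gaps w -> much_sparser w v -> poly_step v ->
  (forall K, \forall n \near \oo, (K * u2 n <= u1 n)%N) ->
  (forall n, (m0 <= n)%N -> (0 < u2 n)%N) -> (forall n, (m3 <= n)%N -> (0 < u3 n)%N) ->
  (forall n, [/\ u1 n <= C0 * 2 ^ n, u2 n <= C0 * 2 ^ n & u3 n <= C0 * 2 ^ n]%N) ->
  uniq ks -> top \in ks ->
  (top.1.1 + top.1.2 = e.+1)%N -> top.2 = c.+1 ->
  (forall k, k \in ks -> (k.1.1 + k.1.2 <= e.+1)%N /\ (k.2 <= D)%N) ->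
  (forall k, k \in ks -> (k.1.1 + k.1.2 = e.+1)%N -> (k.2 <= c.+1)%N) ->
  (forall k, k \in ks -> (k.1.1 + k.1.2 = e.+1)%N -> k.2 = c.+1 ->
     (k.1.1 <= top.1.1)%N) ->
  0 < A top -> (e < D)%N -> (c <= D)%N ->
  \sum_(k <- ks) (A k)%:~R * ((\sum_(m0 <= n < N) (u1 n)%:R * beta^-1 ^+ w n) ^+ k.1.1
     * (\sum_(m0 <= n < N) (u2 n)%:R * beta^-1 ^+ w n) ^+ k.1.2
     * (\sum_(m3 <= n < N) (u3 n)%:R * beta^-1 ^+ v n) ^+ k.2) @[N --> \oo] --> 0 ->
  False.
Proof.
move=> beta gam1 liou wS wG wv vS ratio u2p u3p uC uks tks tope topc kse ksc ksa At eD cD lim0.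
have gam0 : 0 < gam by exact: lt_trans gam1.
have b0 : 0 < beta by rewrite exprn_gt0.
have [KK AKK] : exists KK : nat, \sum_(k <- ks) `|A k| < KK%:Z.
  pose S : int := \sum_(k <- ks) `|A k|; exists `|S|%N.+1.
  have S0 : 0 <= S by apply: sumr_ge0.
  by rewrite -addn1 PoszD gez0_abs // ltzD1.
have [n1 hn1] := near_threshold (ratio KK).
pose n0 := (n1 + m0)%N.
(* [gam ^+ t > 2] turns powers of 2 into powers of [gam], [2 ^+ c2] absorbs the constant of
   [gap_contradiction], and [C1] is such that [B y <= 2 ^ (C1 * y.+1)]. *)
have [t ht] := expr_unbounded 2 gam1.
have t0 : (0 < t)%N.
  by case: (t) ht => //; rewrite expr0 ltNge; case/negP; rewrite ler1n.
have [c2' hc2'] := @expr_unbounded R 2 (2 * (1 - gam^-1)^-1) ltac:(by rewrite ltr1n).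
pose c2 := c2'.+1.
have hc2 : 2 * (1 - gam^-1)^-1 < 2 ^+ c2.
  by apply: lt_le_trans hc2' _; rewrite ler_eXn2l // ltr1n.
pose C1 := (KK + 2 * D * (C0 + 1))%N.
pose B y := (KK * (C0 * 2 ^ y) ^ (2 * D))%N.
have BC y : (B y <= 2 ^ (C1 * y.+1))%N.
  apply: (@leq_trans (2 ^ KK * (2 ^ C0 * 2 ^ y) ^ (2 * D))).
    apply: leq_mul; first exact/ltnW/ltn_expl.
    by apply: leq_exp2; rewrite leq_mul2r (ltnW (ltn_expl _ _)) ?orbT.
  rewrite -expnD -expnM -expnD leq_exp2l //; clear; rewrite /C1; nia.
have two m : (2 ^ m)%N%:R <= gam ^+ (t * m).
  by rewrite natrX exprM; apply: lerXn2r; rewrite ?nnegrE ?exprn_ge0 // ltW.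
have [j0 hj0] := far_tail (t * C1) wS wv.
have [K [r [l [lam [q [L]]]]]] := @choose_scale w v m3 n0 e D t C1 d c2 j0 t0 isT eD wS wG wv vS.
cbv zeta; set kap := (2 * K ^ (r + e.+1))%N; set Om := w kap.
set y := (2 * K ^ (r + e.+1).+1)%N; set g := (t * _)%N.
move=> [[K0 n0y j0Om hbox] [hy hkap hlam] hBd hq [hL m3l qgl vL]].
have [N1 hN1] : exists N1, forall N, (N1 <= N)%N ->
   `|\sum_(k <- ks) (A k)%:~R * ((\sum_(m0 <= n < N) (u1 n)%:R * beta^-1 ^+ w n) ^+ k.1.1
     * (\sum_(m0 <= n < N) (u2 n)%:R * beta^-1 ^+ w n) ^+ k.1.2
     * (\sum_(m3 <= n < N) (u3 n)%:R * beta^-1 ^+ v n) ^+ k.2)| <= beta ^- Om / 4.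
  apply: near_threshold.
  have eps : 0 < beta ^- Om / 4 by rewrite divr_gt0 // invr_gt0 exprn_gt0.
  by have /cvgr0Pnorm_le /(_ _ eps) := lim0.
pose N := (N1 + y + l.+1)%N.
have g0 : (0 < g)%N by rewrite /g muln_gt0 t0 addn_gt0 orbT.
have gamle i j : (i <= j)%N -> gam ^+ i <= gam ^+ j.
  by move=> ij; rewrite ler_weXn2l // ltW.
have yOm n : (y <= n)%N -> (2 * Om <= w n)%N /\ (2 * Om <= v n)%N by exact: hy.
apply: (@no_relation_at_scale R gam d w v u1 u2 u3 m0 m3 n0 N C0 ks A top e c D KK
  K r q g L l kap lam) => //.
- by rewrite leq_addl /= (leq_trans n0y) // /N -addnA addnCA leq_addr.
- by move=> n n0n; apply: hn1; apply: leq_trans n0n; rewrite leq_addr.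
- move=> j n hj hn; have [h1 /andP[h2 h3]] := hbox j n hj hn; split => //.
  by rewrite h2 (leq_trans h3) // /N -addnA addnCA leq_addr.
- by rewrite m3l /N leq_addl.
(* Below [2 * Om] the gap length [g] alone outweighs [B y]; from there on [i - R0] is more than half
   of [i] and [far_tail] applies. *)
- move=> R0 i RO' Ri; have RO : (R0 < Om)%N by []; have [iO|Oi] := ltnP i (2 * Om).
    exists y.
      by move=> n /yOm[h1 h2]; split; exact: leq_trans iO _.
    apply: (@le_trans _ _ (2 ^ (C1 * y.+1))%N%:R); first by rewrite ler_nat; exact: BC.
    apply: le_trans (two _) _; apply: gamle.
    apply: (@leq_trans g); last by move: Ri; clear; lia.
    rewrite /g leq_mul2l; apply/orP; right.
    by apply: leq_trans (leq_addr _ _); rewrite leq_pmull //.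
  have jO : (j0 <= i - R0)%N.
    apply: leq_trans j0Om _; move: RO Oi; clear; lia.
  have [y' ty' hy'] := hj0 _ jO; exists y'.
    have ij : (i <= 2 * (i - R0))%N by move: RO Oi; clear; lia.
    by move=> n /hy'[h1 h2]; split; apply: leq_ltn_trans ij _.
  apply: (@le_trans _ _ (2 ^ (C1 * y'.+1))%N%:R); first by rewrite ler_nat; exact: BC.
  by apply: le_trans (two _) _; apply: gamle; rewrite mulnA.
- exists y.
    move=> n /yOm[h1 h2]; split; [apply: leq_trans h1|apply: leq_trans h2]; rewrite leq_pmull //.
  have By : (B y)%:R ^+ d <= (2 ^+ (d * (C1 * y.+1))) :> R.
    by rewrite -natrX -natrX ler_nat mulnC expnM; apply: leq_exp2.
  have B20 : 0 < 2 ^+ (d * (C1 * y.+1)) :> R by rewrite exprn_gt0.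
  have t00 : 0 < 2 * (1 - gam^-1)^-1.
    by rewrite mulr_gt0 // invr_gt0 subr_gt0 invf_lt1.
  apply: (@le_lt_trans _ _ (2 * (1 - gam^-1)^-1 * 2 ^+ (d * (C1 * y.+1)))).
    by rewrite ler_pM2l.
  apply: (@lt_le_trans _ _ (2 ^+ c2 * 2 ^+ (d * (C1 * y.+1)))).
    by rewrite ltr_pM2r.
  rewrite -exprD -natrX; apply: le_trans (two _) _; apply: gamle.
  rewrite /g leq_mul2l; apply/orP; right; rewrite addnC leq_add2r.
  by rewrite leq_mul2r leqnSn orbT.
- by apply: hN1; rewrite /N -addnA leq_addr.
Qed.

Lemma cvg_expr (R : realType) (u : nat -> R) (a : R) n :
  u x @[x --> \oo] --> a -> (u x) ^+ n @[x --> \oo] --> a ^+ n.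
Proof.
move=> ua; elim: n => [|n IH].
  by under eq_fun do rewrite expr0; rewrite expr0; exact: cvg_cst.
under eq_fun do rewrite exprS.
by rewrite exprS; apply: cvgM.
Qed.

Lemma cvg_sum_seq (R : realType) (T : Type) (s : seq T) (u : T -> nat -> R) (a : T -> R) :
  (forall k, u k x @[x --> \oo] --> a k) ->
  \sum_(k <- s) u k x @[x --> \oo] --> \sum_(k <- s) a k.
Proof.
move=> ua; elim: s => [|k s IH].
  by under eq_fun do rewrite big_nil; rewrite big_nil; exact: cvg_cst.
under eq_fun do rewrite big_cons.
by rewrite big_cons; apply: cvgD.
Qed.

Lemma argmax_seq (T : eqType) (s : seq T) (f : T -> nat) x0 : x0 \in s ->
  exists2 x, x \in s & forall y, y \in s -> (f y <= f x)%N.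
Proof.
elim: s x0 => [//|a [|b s] IH] x0 _.
  by exists a; rewrite ?inE // => y; rewrite inE => /eqP ->.
have [x xs hx] := IH b (mem_head _ _).
have [fxa|fax] := leqP (f x) (f a).
  exists a; first exact: mem_head.
  by move=> y; rewrite inE => /orP[/eqP -> //|/hx h]; exact: leq_trans fxa.
exists x; first by rewrite inE xs orbT.
by move=> y; rewrite inE => /orP[/eqP ->|/hx //]; exact: ltnW.
Qed.

(** The top monomial maximises first the degree in (X1, X2), then the exponent of X3, then that of
    X1; changing the sign of [A] if necessary makes its coefficient positive. *)
Lemma no_relation (R : realType) (gam : R) (d : nat) (w v u1 u2 u3 : nat -> nat)
    (m0 m3 C0 : nat) (f1 f2 f3 : R) :
  let beta := gam ^+ 2 in
  1 < gam ->
  (forall f : {poly int}, (map_poly intr f).[beta] != 0 ->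
     1 <= `|(map_poly intr f).[beta]| * (\sum_(i < size f) `|f`_i|)%:~R ^+ d) ->
  superpolynomial w -> dominating_gaps w -> much_sparser w v -> poly_step v ->
  (forall K, \forall n \near \oo, (K * u2 n <= u1 n)%N) ->
  (forall n, (m0 <= n)%N -> (0 < u2 n)%N) -> (forall n, (m3 <= n)%N -> (0 < u3 n)%N) ->
  (forall n, [/\ u1 n <= C0 * 2 ^ n, u2 n <= C0 * 2 ^ n & u3 n <= C0 * 2 ^ n]%N) ->
  \sum_(m0 <= n < N) (u1 n)%:R * beta^-1 ^+ w n @[N --> \oo] --> f1 ->
  \sum_(m0 <= n < N) (u2 n)%:R * beta^-1 ^+ w n @[N --> \oo] --> f2 ->
  \sum_(m3 <= n < N) (u3 n)%:R * beta^-1 ^+ v n @[N --> \oo] --> f3 ->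
  forall (ks : seq (nat * nat * nat)) (A : nat * nat * nat -> int) k0,
    uniq ks -> k0 \in ks -> (forall k, k \in ks -> A k != 0) ->
    \sum_(k <- ks) (A k)%:~R * (f1 ^+ k.1.1 * f2 ^+ k.1.2 * f3 ^+ k.2) != 0.
Proof.
move=> beta gam1 liou wS wG wv vS ratio u2p u3p uC l1 l2 l3 ks A k0 uks k0ks A0.
apply/negP => /eqP rel0.
have [x xs xmax] := argmax_seq (fun k => k.1.1 + k.1.2)%N k0ks.
pose E := (x.1.1 + x.1.2)%N.
have xE : x \in [seq k <- ks | (k.1.1 + k.1.2)%N == E] by rewrite mem_filter eqxx.
have [z zs zmax] := argmax_seq (fun k => k.2) xE.
have zE : z \in [seq k <- ks | ((k.1.1 + k.1.2)%N == E) && (k.2 == z.2)].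
  by move: zs; rewrite !mem_filter eqxx andbT.
have [top ts tmax] := argmax_seq (fun k => k.1.1) zE.
have [zd _ dmax] := argmax_seq (fun k => k.2) k0ks.
move: ts; rewrite mem_filter => /andP[/andP[/eqP tE /eqP tz] tks].
(* Multiplying the relation by [X1 * X3] makes the leading exponents positive. *)
pose sh (k : nat * nat * nat) := ((k.1.1.+1, k.1.2), k.2.+1).
pose unsh (k : nat * nat * nat) := ((k.1.1.-1, k.1.2), k.2.-1).
have shK : cancel sh unsh by case=> [[? ?] ?].
have imsh k : k \in map sh ks -> exists2 k', k' \in ks & k = sh k' by move/mapP.
pose F1 N := \sum_(m0 <= n < N) (u1 n)%:R * beta^-1 ^+ w n.
pose F2 N := \sum_(m0 <= n < N) (u2 n)%:R * beta^-1 ^+ w n.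
pose F3 N := \sum_(m3 <= n < N) (u3 n)%:R * beta^-1 ^+ v n.
have main (B : nat * nat * nat -> int) : 0 < B top ->
    \sum_(k <- ks) (B k)%:~R * (f1 ^+ k.1.1 * f2 ^+ k.1.2 * f3 ^+ k.2) = 0 -> False.
  move=> Bt rel; apply: (@no_relation_top R gam d w v u1 u2 u3 m0 m3 C0 (map sh ks)
    (B \o unsh) (sh top) E top.2 (E + top.2 + zd.2).+1) => //.
  - by rewrite (map_inj_uniq (can_inj shK)).
  - exact: map_f.
  - by rewrite /= addSn tE.
  - move=> k /imsh[k' k's ->] /=; rewrite addSn !ltnS xmax //; split => //.
    by apply: leq_trans (dmax _ k's) (leq_addl _ _).
  - move=> k /imsh[k' k's ->] /= [] ke; rewrite ltnS tz; apply: zmax.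
    by rewrite mem_filter k's andbT; apply/eqP.
  - move=> k /imsh[k' k's ->] /= [] ke [] kz; rewrite ltnS; apply: tmax.
    by rewrite mem_filter k's andbT kz tz eqxx andbT; apply/eqP.
  - by rewrite /= shK.
  - by rewrite ltnS -addnA leq_addr.
  - by apply: leqW; rewrite addnAC leq_addl.
  rewrite (_ : (fun N => _) = fun N => \sum_(k <- ks) (B k)%:~R *
     (F1 N ^+ k.1.1.+1 * F2 N ^+ k.1.2 * F3 N ^+ k.2.+1)); last first.
    apply: funext => N; rewrite big_map; apply: eq_bigr => k _ /=.
    by rewrite -[unsh (sh k)]/(unsh (sh k)) shK.
  have limE : 0 = \sum_(k <- ks) (B k)%:~R *
     (f1 ^+ k.1.1.+1 * f2 ^+ k.1.2 * f3 ^+ k.2.+1).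
    rewrite (eq_bigr (fun k => (f1 * f3) *
      ((B k)%:~R * (f1 ^+ k.1.1 * f2 ^+ k.1.2 * f3 ^+ k.2)))).
      by rewrite -mulr_sumr rel mulr0.
    by move=> k _; rewrite !exprS; ring.
  rewrite [X in _ --> X]limE; apply: cvg_sum_seq => k; apply: cvgM; first exact: cvg_cst.
  by apply: cvgM; [apply: cvgM|]; apply: cvg_expr.
have := A0 top tks; rewrite neq_lt => /orP[At|At].
  apply: (main (fun k => - A k)); first by rewrite oppr_gt0.
  under eq_bigr do rewrite rmorphN mulNr.
  by rewrite sumrN rel0 oppr0.
exact: (main A).
Qed.

(** * Integer parts and growth conditions for real exponents *)

(** Polynomials need natural exponents; on nonnegative reals this absolute value is the floor
    itself. *)
Definition nfloor (R : realType) (x : R) : nat := `|Num.floor x|%N.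

Lemma nfloor_le (R : realType) (x : R) : 0 <= x -> (nfloor x)%:R <= x.
Proof.
move=> x0; rewrite /nfloor pmulrn gez0_abs ?floor_ge0 //; exact: floor_le.
Qed.

Lemma le_nfloor (R : realType) (x : R) (n : nat) : n%:R <= x -> (n <= nfloor x)%N.
Proof.
move=> nx; have x0 : 0 <= x by apply: le_trans nx.
by rewrite -lez_nat /nfloor gez0_abs ?floor_ge0 // floor_ge_int.
Qed.

Lemma lt_nfloorD1 (R : realType) (x : R) : 0 <= x -> x < (nfloor x)%:R + 1.
Proof.
move=> x0; rewrite /nfloor pmulrn gez0_abs ?floor_ge0 //.
by have /andP[_] := floor_itv x; rewrite rmorphD.
Qed.

Lemma exprz_nfloor (R : realType) (b x : R) : 0 <= x ->
  b ^ (- Num.floor x) = b^-1 ^+ nfloor x.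
Proof.
move=> x0; rewrite /nfloor exprVn -{1}(@gez0_abs (Num.floor x)) ?floor_ge0 //.
by rewrite -exprnN.
Qed.

Lemma near_ln_ge (R : realType) (M : R) : \forall n \near \oo, M <= ln (n%:R : R).
Proof.
exists (Num.bound (expR M)).+1 => // n /= hn.
have h : expR M <= n%:R.
  apply: le_trans (ltW (archi_boundP (expR_ge0 M))) _.
  by rewrite ler_nat ltnW.
by rewrite -(expRK M) ler_ln ?posrE ?expR_gt0 // (lt_le_trans (expR_gt0 M)).
Qed.

Lemma ln_nat_ge0 (R : realType) n : 0 <= ln (n%:R : R).
Proof.
by case: n => [|n]; [rewrite ln0|rewrite ln_ge0 // ler1n].
Qed.

(** The exponents in the role of [w] all have the form exp(t h(t)) with t = log n and h tending to
    infinity, while [n ^ k] is exp(k t). *)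
Lemma superpolynomial_nfloor (R : realType) (h : R -> R) :
  (forall M, exists T, forall t, T <= t -> M <= h t) ->
  superpolynomial (fun n => nfloor (expR (ln n%:R * h (ln n%:R)))).
Proof.
move=> hoo k; have [T hT] := hoo k%:R; near=> n.
have n1 : (0 < n)%N by near: n; exact: nbhs_infty_ge.
apply: le_nfloor; rewrite natrX -{1}(@lnK R n%:R) ?posrE ?ltr0n //.
rewrite -expRM_natl ler_expR mulrC ler_wpM2l ?ln_nat_ge0 //.
apply: hT; near: n; exact: near_ln_ge.
Unshelve. all: by end_near.
Qed.

(** Write W(n) = exp(t h(t)). Once h(t) >= 2 (s + 1), the premise on [n'] gives W(n') n^2 <= W(n),
    while h >= 1 gives W(n+1) >= W(n) (1 + 1/n); the increment W(n)/n is thus at least 2 W(n'). *)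
Lemma dominating_gaps_nfloor (R : realType) (h : R -> R) :
  (forall t t', 0 < t' -> t' <= t -> h t' <= h t) ->
  (forall M, exists T, forall t, T <= t -> M <= h t) ->
  dominating_gaps (fun n => nfloor (expR (ln n%:R * h (ln n%:R)))).
Proof.
move=> hmono hoo s; have [T hT] := hoo (2 * s.+1%:R); near=> n => n' n'n.
have n2 : (2 <= n)%N by near: n; exact: nbhs_infty_ge.
have nn0 : (0 < n)%N by exact: leq_trans n2.
have n0 : 0 < n%:R :> R by rewrite ltr0n (leq_trans _ n2).
have n10 : 0 < n.+1%:R :> R by rewrite ltr0n.
set t := ln (n%:R : R).
have tT : T <= t by rewrite /t; near: n; exact: near_ln_ge.
have t1 : 1 <= t by rewrite /t; near: n; exact: near_ln_ge.
have t0 : 0 < t by rewrite (lt_le_trans ltr01).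
have hM := hT t tT.
pose W m : R := expR (ln m%:R * h (ln m%:R)).
have s0 : 0 < s.+1%:R :> R by [].
have ht1 : 1 <= h t.
  by apply: le_trans hM; rewrite -[leLHS]mulr1 ler_pM ?ler1n.
pose t' := ln (n'%:R : R).
have t'0 : 0 <= t' by exact: ln_nat_ge0.
have st : s.+1%:R * t' <= s%:R * t.
  (* For [n' = 0] the logarithm has the default value 0. *)
  case: (posnP n') => [n'0|n'0].
    by rewrite /t' n'0 ln0 // mulr0 mulr_ge0 // ltW.
  rewrite /t /t' ![_%:R * ln _]mulr_natl -!lnXn ?ltr0n //.
  rewrite ler_ln ?posrE ?exprn_gt0 ?ltr0n //.
  by rewrite -!natrX ler_nat.
have tt' : t' <= t.
  rewrite -(ler_pM2l s0); apply: le_trans st _.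
  by rewrite ler_pM2r // ler_nat.
have W' : W n' * n%:R ^+ 2 <= W n.
  rewrite /W -/t -/t' -[X in _ * X ^+ _](@lnK R) ?posrE // -/t -expRM_natl -expRD ler_expR.
  apply: (@le_trans _ _ (t' * h t + 2 * t)).
    (* [h] is only assumed monotone on positive arguments, so [t' = 0] is treated apart. *)
    rewrite lerD2r; move: t'0; rewrite le_eqVlt => /orP[/eqP <-|t'0]; first by rewrite !mul0r.
    by rewrite ler_pM2l // hmono.
  rewrite -(ler_pM2l s0).
  have e1 : s.+1%:R * t' * h t <= s%:R * t * h t by rewrite ler_pM2r // (lt_le_trans ltr01).
  have e2 : 2 * s.+1%:R * t <= h t * t by rewrite ler_pM2r.
  have e3 : s.+1%:R = s%:R + 1 :> R by rewrite natr1.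
  move: e1 e2; rewrite e3; clear; nra.
have W1 : W n * (1 + n%:R^-1) <= W n.+1.
  have lnS : ln (n.+1%:R : R) = t + ln (1 + n%:R^-1).
    rewrite /t -lnM ?posrE ?addr_gt0 ?invr_gt0 //.
    by rewrite mulrDr mulr1 divff ?gt_eqF // natr1.
  have l0 : 0 < 1 + n%:R^-1 :> R by rewrite addr_gt0 // invr_gt0.
  have ln10 : 0 <= ln (1 + n%:R^-1 : R) by rewrite ln_ge0 // lerDl invr_ge0 ltW.
  rewrite -{1}(@lnK R (1 + n%:R^-1)) ?posrE // /W -/t -expRD ler_expR.
  apply: (@le_trans _ _ (ln n.+1%:R * h t)).
    by rewrite lnS mulrDl lerD2l ler_peMr.
  rewrite ler_wpM2l ?ln_nat_ge0 // hmono // lnS lerDl //.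
rewrite -[X in (X <= _)%N]natn.
apply: le_nfloor; rewrite -/(W n.+1) natn natrD natrM.
have Wn0 m : 0 < W m by exact: expR_gt0.
have f1 : (nfloor (W n))%:R <= W n by apply: nfloor_le; exact: ltW.
have f2 : (nfloor (W n'))%:R <= W n' by apply: nfloor_le; exact: ltW.
apply: (@le_trans _ _ (W n + 2 * W n')); first by rewrite lerD // ler_pM2l.
apply: le_trans W1; rewrite mulrDr mulr1 lerD2l ler_pdivlMr //.
apply: le_trans W'; rewrite expr2 mulrA ler_pM2r // mulrC ler_pM2l // ler_nat.
exact: n2.
Unshelve. all: by end_near.
Qed.

Lemma much_sparser_nfloor (R : realType) (W V : nat -> R) :
  (forall n, 0 <= W n) -> (forall k, \forall n \near \oo, W (n ^ k)%N <= V n) ->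
  much_sparser (fun n => nfloor (W n)) (fun n => nfloor (V n)).
Proof.
move=> W0 h k; near=> n; apply: le_nfloor; apply: le_trans (nfloor_le (W0 _)) _.
by near: n; exact: h.
Unshelve. all: by end_near.
Qed.

(** Passing to the floor f of V(n) doubles the exponent: V(n) < f + 1 <= f^2 once f >= 2. *)
Lemma poly_step_nfloor (R : realType) (V : nat -> R) (b : nat) :
  (forall n, 0 <= V n) -> (\forall n \near \oo, 3 <= V n) ->
  (\forall n \near \oo, V n.+1 <= V n ^+ b) ->
  poly_step (fun n => nfloor (V n)).
Proof.
move=> V0 V3 Vb; exists (2 * b)%N; near=> n.
rewrite -(ler_nat R) natrX; apply: le_trans (nfloor_le (V0 _)) _.
have h1 : V n.+1 <= V n ^+ b by near: n; exact: Vb.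
have h3 : 3 <= V n by near: n; exact: V3.
apply: le_trans h1 _; rewrite exprM; apply: lerXn2r; rewrite ?nnegrE //.
have := lt_nfloorD1 (V0 n); set f := (nfloor (V n))%:R => f1.
have f2 : 2 <= f by lra.
by clearbody f; move: f1 f2; clear; nra.
Unshelve. all: by end_near.
Qed.

(** * Convergence of the series and reduction to the growth conditions *)

(** The terms are nonnegative and dominated by a geometric series: the exponents are eventually at
    least n^2 >= t n with beta^t > 4, which beats the bound [C0 * 2 ^ n] on the coefficients. *)
Lemma power_sum_cvg (R : realType) (beta : R) m (u : nat -> nat) (W : nat -> R) C0 :
  1 < beta -> (forall n, 0 <= W n) -> superpolynomial (fun n => nfloor (W n)) ->
  (forall n, (u n <= C0 * 2 ^ n)%N) ->
  \sum_(m <= n < N) (u n)%:R * beta^-1 ^+ nfloor (W n) @[N --> \oo] -->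
    power_sum beta m u W.
Proof.
move=> b1 W0 Wsup uC; rewrite /power_sum.
have b0 : 0 < beta by exact: lt_trans b1.
have th0 : 0 < beta^-1 by rewrite invr_gt0.
rewrite (_ : (fun N => \sum_(m <= n < N) (u n)%:R * beta ^ _) =
  fun N => \sum_(m <= n < N) (u n)%:R * beta^-1 ^+ nfloor (W n)); last first.
  by apply: funext => N; apply: eq_bigr => n _; rewrite exprz_nfloor.
pose a n : R := (u n)%:R * beta^-1 ^+ nfloor (W n).
have a0 n : 0 <= a n by rewrite mulr_ge0 // exprn_ge0 // ltW.
have [t ht] := expr_unbounded 4 b1.
have [n1 hn1] := near_threshold (Wsup 2).
have half n : (n1 + t <= n)%N -> a n <= C0%:R * 2^-1 ^+ n.
  move=> nn; rewrite /a; have u2 : (u n)%:R <= C0%:R * 2 ^+ n :> R.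
    by rewrite -natrX -natrM ler_nat.
  have h4 : beta^-1 ^+ nfloor (W n) <= 4^-1 ^+ n.
    rewrite !exprVn lef_pV2 ?posrE ?exprn_gt0 //.
    apply: (@le_trans _ _ (beta ^+ (t * n))).
      by rewrite exprM; apply: lerXn2r; rewrite ?nnegrE ?exprn_ge0 // ltW.
    rewrite ler_weXn2l // ?(ltW b1) //; apply: leq_trans (hn1 _ _).
      by rewrite -mulnn leq_mul2r (leq_trans (leq_addl _ _) nn) orbT.
    exact: leq_trans (leq_addr _ _) nn.
  apply: (@le_trans _ _ (C0%:R * 2 ^+ n * 4^-1 ^+ n)).
    by apply: ler_pM; rewrite ?exprn_ge0 // ltW.
  rewrite -mulrA -exprMn ler_wpM2l // (_ : 2 / 4 = 2^-1) //.
  by rewrite (_ : 4 = 2 * 2 :> R) ?invfM ?mulrA ?divff ?mul1r // -natrM.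
(* The added sum makes the geometric bound hold at the finitely many first indices as well. *)
pose D0 : R := C0%:R + \sum_(i < n1 + t) a i * 2 ^+ i.
have D00 : 0 <= \sum_(i < n1 + t) a i * 2 ^+ i.
  by apply: sumr_ge0 => i _; rewrite mulr_ge0 // exprn_ge0.
have aD n : a n <= D0 * 2^-1 ^+ n.
  have [nn|nn] := leqP (n1 + t) n.
    apply: le_trans (half n nn) _; apply: ler_wpM2r; first by rewrite exprn_ge0 // invr_ge0.
    by rewrite lerDl.
  rewrite exprVn ler_pdivlMr ?exprn_gt0 // /D0 (bigD1 (Ordinal nn)) //= addrCA lerDl.
  by rewrite addr_ge0 // sumr_ge0 // => i _; rewrite mulr_ge0 // exprn_ge0.
apply: nondecreasing_is_cvgn.
  move=> i j ij; have [mi|im] := leqP m i.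
    by rewrite (@big_cat_nat _ _ _ i m j) //= lerDl sumr_ge0 // => n _; exact: a0.
  by rewrite big_geq ?(ltnW im) // sumr_ge0 // => n _; exact: a0.
exists (D0 * (1 - 2^-1)^-1) => _ [N _ <-].
apply: (@le_trans _ _ (\sum_(m <= n < N) D0 * 2^-1 ^+ n)).
  by apply: ler_sum => n _; exact: aD.
have D0p : 0 <= D0 by rewrite addr_ge0.
rewrite -mulr_sumr ler_wpM2l //.
apply: (@le_trans _ _ (\sum_(0 <= n < N) 2^-1 ^+ n)).
  have [mN|Nm] := leqP m N.
    rewrite (big_cat_nat (leq0n m) mN) /= lerDr; apply: sumr_ge0 => n _.
    by rewrite exprn_ge0 // invr_ge0.
  rewrite big_geq ?(ltnW Nm) //; apply: sumr_ge0 => n _.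
  by rewrite exprn_ge0 // invr_ge0.
rewrite big_mkord; apply: geometric_sum_le; first by rewrite invr_ge0.
by rewrite invf_lt1 // ltr1n.
Qed.

(** Since n^(1-C) <= n for n >= 1, the little-o condition with constant log 2 yields [u n <= 2 ^ n]
    eventually; [C0] absorbs the other indices. *)
Lemma subexponential_littleo (R : realType) (u : nat -> nat) (C : R) : 0 < C < 1 ->
  (fun n => log_plus (u n)%:R : R^o) =o_\oo (fun n => n%:R `^ (1 - C) : R^o) ->
  exists C0, forall n, (u n <= C0 * 2 ^ n)%N.
Proof.
move=> /andP[C0 C1] /eqoP ho.
have l2 : 0 < ln 2 :> R by rewrite ln_gt0 // ltr1n.
have [n1 hn1] := near_threshold (ho _ l2).
have small n : (n1 < n)%N -> (u n <= 2 ^ n)%N.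
  move=> nn; have := hn1 n (ltnW nn).
  have n1R : 1 <= n%:R :> R by rewrite ler1n (leq_trans _ nn).
  rewrite [X in _ <= _ * X]ger0_norm ?powR_ge0 // => h.
  have h2 : log_plus (u n)%:R <= ln (2 ^+ n : R).
    apply: le_trans (ler_norm _) _; apply: le_trans h _.
    rewrite lnXn // -[leRHS]mulr_natr ler_pM2l //.
    apply: (@le_trans _ _ (n%:R `^ 1)); last by rewrite powRr1.
    by apply: ler_powR => //; rewrite lerBlDr lerDl ltW.
  move: h2; rewrite /log_plus ler_ln ?posrE ?exprn_gt0 ?lt_max ?ltr01 // ge_max.
  by move=> /andP[_]; rewrite -natrX ler_nat.
exists (1 + \sum_(i < n1.+1) u i)%N => n.
have [nn|nn] := ltnP n1 n.
  by apply: leq_trans (small n nn) _; rewrite leq_pmull.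
apply: (@leq_trans (1 + \sum_(i < n1.+1) u i)); last by rewrite leq_pmulr // expn_gt0.
have nn' : (n < n1.+1)%N by rewrite ltnS.
by rewrite (bigD1 (Ordinal nn')) //= addnCA leq_addr.
Qed.

(** Passes from multivariate polynomials to lists of exponent triples: the support of [P] has no
    repetition, and the coefficients on it are nonzero. *)
Lemma algebraically_independent3 (R : realType) (f1 f2 f3 : R) :
  (forall (ks : seq (nat * nat * nat)) (A : nat * nat * nat -> int) k0,
    uniq ks -> k0 \in ks -> (forall k, k \in ks -> A k != 0) ->
    \sum_(k <- ks) (A k)%:~R * (f1 ^+ k.1.1 * f2 ^+ k.1.2 * f3 ^+ k.2) != 0) ->
  algebraically_independent [tuple f1; f2; f3].
Proof.
move=> indep P P0.
pose i0 : 'I_3 := @Ordinal 3 0 isT; pose i1 : 'I_3 := @Ordinal 3 1 isT.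
pose i2 : 'I_3 := @Ordinal 3 2 isT.
pose c := @mpoly.fun_of_multinom 3.
pose toK (m : mpoly.multinom 3) : nat * nat * nat := ((c m i0, c m i1), c m i2).
pose ofK (k : nat * nat * nat) := mpoly.Multinom [tuple k.1.1; k.1.2; k.2].
have toKK : cancel toK ofK.
  move=> m; apply/mpoly.mnmP => i; rewrite /ofK /toK /=.
  case: i => [[|[|[|i]]] hi] //; rewrite mpoly.multinomE (tnth_nth 0%N) /=;
    by congr (mpoly.fun_of_multinom m _); apply: val_inj.
have supp0 : mpoly.msupp P != [::].
  by apply/eqP => /mpoly.msuppnil0.
have [m0 m0P] : exists m0, m0 \in mpoly.msupp P.
  by case: (mpoly.msupp P) supp0 => // m s _; exists m; exact: mem_head.
have := indep (map toK (mpoly.msupp P)) (fun k => mpoly.mcoeff (ofK k) P) (toK m0).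
rewrite (map_inj_uniq (can_inj toKK)) mpoly.msupp_uniq => /(_ isT (map_f _ m0P)) h.
have A0 k : k \in map toK (mpoly.msupp P) -> mpoly.mcoeff (ofK k) P != 0.
  by move=> /mapP[m mP ->]; rewrite toKK -mpoly.mcoeff_msupp.
move=> E; case/eqP: (h A0).
rewrite -[RHS]E big_map /mpoly.mmap; apply: eq_bigr => m _.
rewrite toKK; congr (_ * _); rewrite /mpoly.mmap1 !big_ord_recl big_ord0 mulr1.
rewrite !mulrA /toK /c; congr (_ ^+ _ * _ ^+ _ * _ ^+ _);
  by rewrite ?(tnth_nth 0) //=; congr (mpoly.fun_of_multinom m _); apply: val_inj.
Qed.

(** Reduces each of the three assertions to growth conditions on the integer parts of the
    exponents. *)
Lemma independence_of_growth (R : realType) (beta : R) (u1 u2 u3 : nat -> nat) (C : R)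
    (m0 m3 : nat) (W V : nat -> R) :
  Pisot beta \/ Salem beta ->
  (forall n, (1 <= n)%N -> (0 < u2 n)%N) ->
  (forall n, (1 <= n)%N -> (0 < u3 n)%N) ->
  0 < C < 1 ->
  (fun n => log_plus (u1 n)%:R : R^o) =o_\oo (fun n => n%:R `^ (1 - C) : R^o) ->
  (fun n => log_plus (u2 n)%:R : R^o) =o_\oo (fun n => n%:R `^ (1 - C) : R^o) ->
  (fun n => log_plus (u3 n)%:R : R^o) =o_\oo (fun n => n%:R `^ (1 - C) : R^o) ->
  (u1 n)%:R / (u2 n)%:R @[n --> \oo] --> (+oo : set_system R) ->
  (1 <= m0)%N -> (1 <= m3)%N ->
  (forall n, 0 <= W n) -> (forall n, 0 <= V n) ->
  superpolynomial (fun n => nfloor (W n)) -> dominating_gaps (fun n => nfloor (W n)) ->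
  much_sparser (fun n => nfloor (W n)) (fun n => nfloor (V n)) ->
  poly_step (fun n => nfloor (V n)) ->
  algebraically_independent
    [tuple power_sum beta m0 u1 W; power_sum beta m0 u2 W; power_sum beta m3 u3 V].
Proof.
move=> hb u2p u3p hC /(subexponential_littleo hC)[C1 h1]
  /(subexponential_littleo hC)[C2 h2] /(subexponential_littleo hC)[C3 h3] ratio
  m01 m31 W0 V0 wS wG wv vS.
have b1 : 1 < beta by case: hb => -[].
have [d liou] := pisot_salem_liouville hb.
have b0 : 0 < beta by exact: lt_trans b1.
pose gam := Num.sqrt beta.
have g2 : gam ^+ 2 = beta by rewrite sqr_sqrtr // ltW.
have gam1 : 1 < gam.
  have g0 : 0 <= gam by exact: sqrtr_ge0.
  by rewrite ltNge; apply/negP => g1; move: b1; rewrite -g2 ltNge exprn_ile1.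
pose C0 := (C1 + C2 + C3)%N.
have uC n : [/\ u1 n <= C0 * 2 ^ n, u2 n <= C0 * 2 ^ n & u3 n <= C0 * 2 ^ n]%N.
  split; [apply: leq_trans (h1 n) _|apply: leq_trans (h2 n) _|apply: leq_trans (h3 n) _];
    by rewrite leq_mul2r /C0; apply/orP; right; clear; lia.
(* The convergence of the third series rests on this growth, inherited from [w <= v]. *)
have vP : superpolynomial (fun n => nfloor (V n)).
  move=> k; near=> n; apply: (@leq_trans (nfloor (W n))).
    by near: n; exact: wS.
  rewrite -{1}(expn1 n); near: n; exact: wv.
apply: algebraically_independent3 => ks A k0 uks k0ks A0.
have lim1 : \sum_(m0 <= n < N) (u1 n)%:R * beta^-1 ^+ nfloor (W n) @[N --> \oo] -->
    power_sum beta m0 u1 W.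
  by apply: (@power_sum_cvg R beta m0 u1 W C0) => // n; have [] := uC n.
have lim2 : \sum_(m0 <= n < N) (u2 n)%:R * beta^-1 ^+ nfloor (W n) @[N --> \oo] -->
    power_sum beta m0 u2 W.
  by apply: (@power_sum_cvg R beta m0 u2 W C0) => // n; have [] := uC n.
have lim3 : \sum_(m3 <= n < N) (u3 n)%:R * beta^-1 ^+ nfloor (V n) @[N --> \oo] -->
    power_sum beta m3 u3 V.
  by apply: (@power_sum_cvg R beta m3 u3 V C0) => // n; have [] := uC n.
have rat K : \forall n \near \oo, (K * u2 n <= u1 n)%N.
  near=> n; have n1 : (1 <= n)%N by near: n; exact: nbhs_infty_ge.
  have : K%:R <= (u1 n)%:R / (u2 n)%:R :> R.
    by near: n; move/cvgryPge : ratio; apply.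
  by rewrite ler_pdivlMr ?ltr0n ?u2p // -natrM ler_nat.
have := @no_relation R gam d (fun n => nfloor (W n)) (fun n => nfloor (V n)) u1 u2 u3 m0 m3 C0
  (power_sum beta m0 u1 W) (power_sum beta m0 u2 W) (power_sum beta m3 u3 V).
rewrite g2 => rel; apply: (rel gam1 liou wS wG wv vS rat _ _ uC lim1 lim2 lim3 ks A k0) => //.
- by move=> n hn; apply: u2p; exact: leq_trans hn.
- by move=> n hn; apply: u3p; exact: leq_trans hn.
Unshelve. all: by end_near.
Qed.

(** * Estimates for the particular exponents and the conclusion *)

Lemma powR_unbounded (R : realType) (x : R) : 0 < x ->
  forall M, exists T, forall t, T <= t -> M <= t `^ x.
Proof.
move=> x0 M; exists (expR (`|M| / x)) => t tT.
have t0 : 0 < t by rewrite (lt_le_trans (expR_gt0 _) tT).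
have h : `|M| / x <= ln t by rewrite -(expRK (_ / _)) ler_ln ?posrE ?expR_gt0.
rewrite ler_pdivrMr // mulrC in h.
rewrite /powR gt_eqF //; apply: le_trans (ler_norm _) (le_trans h _).
by apply: le_trans (expR_ge1Dx _); rewrite lerDr.
Qed.

(** With s = log z, exp(s) >= 1 + s^2 / 2 >= M s once s >= 2 M. *)
Lemma mul_ln_le (R : realType) (M : R) : 0 <= M ->
  exists T, forall z, T <= z -> M * ln z <= z.
Proof.
move=> M0; exists (expR (2 * M)) => z Tz.
have z0 : 0 < z by rewrite (lt_le_trans (expR_gt0 _) Tz).
have h : 2 * M <= ln z by rewrite -(expRK (2 * M)) ler_ln ?posrE ?expR_gt0.
have l0 : 0 <= ln z by rewrite (le_trans _ h) // mulr_ge0.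
have := expR_ge1Dxn 1 l0; rewrite lnK ?posrE // (_ : 2`! = 2)%N //.
by move: h l0; set s := ln z; clearbody s; clear; nra.
Qed.

Lemma near_powR_ln_ge (R : realType) (x M : R) : 0 < x ->
  \forall n \near \oo, M <= ln (n%:R : R) `^ x.
Proof.
move=> x0; have [T hT] := powR_unbounded x0 M; near=> n; apply: hT.
by near: n; exact: near_ln_ge.
Unshelve. all: by end_near.
Qed.

Lemma powR1D (R : realType) (x t : R) : 0 < x -> 0 <= t -> t `^ (1 + x) = t * t `^ x.
Proof.
move=> x0; rewrite le_eqVlt => /orP[/eqP <-|t0].
  by rewrite mul0r powR0 // gt_eqF // addr_gt0.
rewrite powRD; first by rewrite powRr1 // ltW.
by apply/implyP => _; rewrite gt_eqF.
Qed.

Lemma ln_natS_le (R : realType) n : (2 <= n)%N -> ln (n.+1%:R : R) <= 2 * ln n%:R.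
Proof.
move=> n2; have n0 : (0 < n)%N by exact: leq_trans n2.
rewrite mulr_natl -lnXn ?ltr0n // ler_ln ?posrE ?exprn_gt0 ?ltr0n //.
by rewrite -natrX ler_nat -mulnn (leq_trans _ (leq_mul n2 (leqnn n))) // mul2n -addnn; lia.
Qed.

Lemma near_expR_ge (R : realType) (f : nat -> R) M :
  (\forall n \near \oo, M <= f n) -> \forall n \near \oo, M <= expR (f n).
Proof.
move=> h; near=> n; apply: le_trans (expR_ge1Dx _).
by apply: (@le_trans _ _ (f n)); [near: n|rewrite lerDr].
Unshelve. all: by end_near.
Qed.

Lemma ln_natX (R : realType) n k : ln ((n ^ k)%N%:R : R) = k%:R * ln n%:R.
Proof.
case: n => [|n]; last by rewrite natrX lnXn // mulr_natl.
by case: k => [|k]; rewrite ?expn0 ?exp0n // ?ln1 ?mul0r // ln0 // mulr0.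
Qed.

(** From log(n+1) <= 2 log n, the quantity (log n)^(1+y) grows at most by the factor 2^(1+y), and
    [b] is an integer above it. *)
Lemma poly_step_powR (R : realType) (y : R) : 0 < y ->
  poly_step (fun n => nfloor (expR (ln n%:R `^ (1 + y)) : R)).
Proof.
move=> y0; have y1 : 0 < 1 + y by rewrite addr_gt0.
pose b := Num.bound (2 `^ (1 + y)).
apply: (@poly_step_nfloor R _ b).
- by move=> n; rewrite expR_ge0.
- by apply: near_expR_ge; exact: near_powR_ln_ge.
near=> n; have n2 : (2 <= n)%N by near: n; exact: nbhs_infty_ge.
rewrite -expRM_natl ler_expR.
have l0 := ln_nat_ge0 R n.
apply: (@le_trans _ _ ((2 * ln n%:R) `^ (1 + y))).
  by apply: ge0_ler_powR; rewrite ?nnegrE ?(ltW y1) ?ln_nat_ge0 ?mulr_ge0 // ln_natS_le.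
rewrite powRM // ler_wpM2r ?powR_ge0 //.
by apply/ltW/archi_boundP; rewrite powR_ge0.
Unshelve. all: by end_near.
Qed.

Lemma poly_step_ln_sq (R : realType) :
  poly_step (fun n => nfloor (expR (ln n%:R * ln n%:R) : R)).
Proof.
have := @poly_step_powR R 1 ltr01; congr poly_step; apply: funext => n.
by rewrite powR1D ?ln_nat_ge0 // powRr1 ?ln_nat_ge0.
Qed.

Theorem theorem1 (R : realType) (beta : R) (u1 u2 u3 : nat -> nat)
    (hbeta : Pisot beta \/ Salem beta)
    (u1_gt0 : forall n, (1 <= n)%N -> (0 < u1 n)%N)
    (u2_gt0 : forall n, (1 <= n)%N -> (0 < u2 n)%N)
    (u3_gt0 : forall n, (1 <= n)%N -> (0 < u3 n)%N)
    (hgrowth : exists C : R,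
       [/\ 0 < C < 1,
           (fun n => log_plus (u1 n)%:R : R^o) =o_\oo (fun n => n%:R `^ (1 - C) : R^o),
           (fun n => log_plus (u2 n)%:R : R^o) =o_\oo (fun n => n%:R `^ (1 - C) : R^o) &
           (fun n => log_plus (u3 n)%:R : R^o) =o_\oo (fun n => n%:R `^ (1 - C) : R^o)])
    (hratio : (u1 n)%:R / (u2 n)%:R @[n --> \oo] --> (+oo : set_system R)) :
  [/\ forall x y : R, 0 < x -> x < y ->
        algebraically_independent
          [tuple power_sum beta 1 u1 (fun n => expR (ln n%:R `^ (1 + x)));
                 power_sum beta 1 u2 (fun n => expR (ln n%:R `^ (1 + x)));
                 power_sum beta 1 u3 (fun n => expR (ln n%:R `^ (1 + y)))],
      algebraically_independent
        [tuple power_sum beta 3 u1 (fun n => n%:R `^ ln (ln n%:R));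
               power_sum beta 3 u2 (fun n => n%:R `^ ln (ln n%:R));
               power_sum beta 1 u3 (fun n => n%:R `^ ln n%:R)] &
      forall r : R, 1 < r ->
        algebraically_independent
          [tuple power_sum beta 1 u1 (fun n => n%:R `^ ln n%:R);
                 power_sum beta 1 u2 (fun n => n%:R `^ ln n%:R);
                 power_sum beta 1 u3 (fun n => r ^+ n)]].
Proof.
have [C [hC o1 o2 o3]] := hgrowth.
have indep := @independence_of_growth R beta u1 u2 u3 C _ _ _ _ hbeta u2_gt0 u3_gt0
  hC o1 o2 o3 hratio.
(* At [n = 0] both sides are 1, by [ln 0 = 0], [h 0 = 0] and the convention that 0 to the power 0 is
   1. *)
have powE (h : R -> R) : h 0 = 0 -> (fun n : nat => n%:R `^ h (ln n%:R)) =
    (fun n => expR (ln n%:R * h (ln n%:R))).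
  move=> h0; apply: funext => -[|n].
    by rewrite ln0 // h0 mulr0 expR0 /powR !eqxx.
  by rewrite /powR pnatr_eq0 /= mulrC.
have sqE : (fun n : nat => n%:R `^ ln n%:R) = (fun n => expR (ln n%:R * ln (n%:R : R))).
  exact: (powE id).
have idoo (M : R) : exists T, forall t, T <= t -> M <= t by exists M.
split.
- move=> x y x0 xy; have y0 : 0 < y by exact: lt_trans xy.
  apply: indep => //.
  - rewrite [X in superpolynomial X](_ : _ =
        fun n => nfloor (expR (ln n%:R * (ln (n%:R : R) `^ x)))).
      exact: (superpolynomial_nfloor (powR_unbounded x0)).
    by apply: funext => n; rewrite powR1D // ln_nat_ge0.
  - rewrite [X in dominating_gaps X](_ : _ =
        fun n => nfloor (expR (ln n%:R * (ln (n%:R : R) `^ x)))).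
      apply: (@dominating_gaps_nfloor R (fun t => t `^ x)); last exact: powR_unbounded.
      move=> t t' t'0 tt'; have t0 : 0 < t by exact: lt_le_trans tt'.
      by apply: ge0_ler_powR; rewrite ?nnegrE ?(ltW x0) ?(ltW t0) ?(ltW t'0).
    by apply: funext => n; rewrite powR1D // ln_nat_ge0.
  (* With t = log n, (k t)^(1+x) <= t^(y-x) t^(1+x) as soon as t^(y-x) >= k^(1+x). *)
  - apply: much_sparser_nfloor => [n|k]; first by rewrite expR_ge0.
    near=> n; rewrite ler_expR ln_natX powRM ?ln_nat_ge0 //.
    have l1 : 1 <= ln (n%:R : R) by near: n; exact: near_ln_ge.
    have -> : 1 + y = (y - x) + (1 + x) by ring.
    rewrite [leRHS]powRD; last by apply/implyP => _; rewrite gt_eqF // (lt_le_trans ltr01).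
    apply: ler_wpM2r; first by rewrite powR_ge0.
    by near: n; apply: near_powR_ln_ge; rewrite subr_gt0.
  - exact: poly_step_powR.
- rewrite (powE (@ln R)) ?ln0 // sqE.
  apply: indep => //.
  - apply: (@superpolynomial_nfloor R (@ln R)) => M; exists (expR M) => t Mt.
    by rewrite -(expRK M) ler_ln ?posrE ?expR_gt0 // (lt_le_trans (expR_gt0 M)).
  - apply: (@dominating_gaps_nfloor R (@ln R)) => [t t' t'0 tt'|M].
      by rewrite ler_ln ?posrE // (lt_le_trans t'0).
    exists (expR M) => t Mt.
    by rewrite -(expRK M) ler_ln ?posrE ?expR_gt0 // (lt_le_trans (expR_gt0 M)).
  - apply: much_sparser_nfloor => [n|k]; first by rewrite expR_ge0.
    (* For [k = 0] the left side is the value 1 at index 1; the estimate for positive [k] divides by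
       [k]. *)
    case: k => [|k].
      near=> n; rewrite expn0 ln1 mul0r expR0.
      by apply: le_trans (expR_ge1Dx _); rewrite lerDl mulr_ge0 // ln_nat_ge0.
    (* Writing k for [k.+1]: at z = k t this gives k^2 log(k t) <= k t, that is k log(k t) <= t. *)
    have [T hT] := @mul_ln_le R (k.+1%:R ^+ 2) ltac:(by rewrite exprn_ge0).
    near=> n; rewrite ler_expR ln_natX.
    have l1 : 1 <= ln (n%:R : R) by near: n; exact: near_ln_ge.
    have lT : T <= ln (n%:R : R) by near: n; exact: near_ln_ge.
    move: l1 lT; set t := ln n%:R => l1 lT.
    have k1 : 1 <= k.+1%:R :> R by rewrite ler1n.
    have t0 : 0 < t by rewrite (lt_le_trans ltr01).
    have tk : T <= k.+1%:R * t by rewrite (le_trans lT) // ler_peMl // ltW.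
    have := hT _ tk; set l := ln _ => hl.
    rewrite [_ * t]mulrC -mulrA ler_pM2l //.
    rewrite -(ler_pM2l (lt_le_trans ltr01 k1)); apply: le_trans hl.
    by rewrite expr2 mulrA.
  - exact: poly_step_ln_sq.
- move=> r r1; rewrite sqE.
  have r0 : 0 < r by exact: lt_trans r1.
  have lr : 0 < ln r by rewrite ln_gt0.
  apply: indep => //.
  - by move=> n; rewrite exprn_ge0 // ltW.
  - exact: (@superpolynomial_nfloor R id).
  - exact: (@dominating_gaps_nfloor R id).
  - apply: much_sparser_nfloor => [n|k]; first by rewrite expR_ge0.
    near=> n; rewrite ln_natX -(@lnK R r) // -expRM_natl ler_expR.
    have n0 : (0 < n)%N by near: n; exact: nbhs_infty_ge.
    (* From n = exp(t) >= t^3 / 6, the inequality (k t)^2 <= n log r follows once t log r >= 6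
       k^2. *)
    have lT : 6 * (k%:R ^+ 2) / ln r <= ln (n%:R : R) by near: n; exact: near_ln_ge.
    have := @expR_ge1Dxn R _ 2 (ln_nat_ge0 R n); rewrite lnK ?posrE ?ltr0n //.
    rewrite (_ : 3`! = 6)%N // => h6.
    have l0 := ln_nat_ge0 R n.
    move: lT h6 l0; rewrite ler_pdivrMr //; set t := ln n%:R => lT h6 l0.
    apply: (@le_trans _ _ (t ^+ 3 / 6 * ln r)); last first.
      by rewrite ler_pM2r // (le_trans _ h6) // lerDr.
    have : t ^+ 2 * (6 * k%:R ^+ 2) <= t ^+ 2 * (t * ln r) by rewrite ler_wpM2l ?sqr_ge0.
    rewrite !exprS !expr0; lra.
  - apply: (@poly_step_nfloor R _ 2).
    + by move=> n; rewrite exprn_ge0 // ltW.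
    + have [n1 hn1] := expr_unbounded 3 r1.
      near=> n; apply: le_trans (ltW hn1) _; rewrite ler_weXn2l // ?ltW //.
      by near: n; exact: nbhs_infty_ge.
    + near=> n; have n0 : (1 <= n)%N by near: n; exact: nbhs_infty_ge.
      by rewrite -exprM ler_weXn2l ?ltW // muln2 -addnn -addn1 leq_add2l.
Unshelve. all: by end_near.
Qed.
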